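(* Let $\Omega\subset\mathbb{R}^d$ be open, $1<p<\infty$, and let $\nu:\mathbb{R}^d\setminus\{0\}\to[0,\infty)$ be measurable and symmetric with $\int_{\mathbb{R}^d}(1\wedge|h|^p)\nu(h)\,dh<\infty$. Let $\omega\in\{\widetilde\nu_\Omega,\overline\nu_\Omega,\widehat\nu_R\}$, where $R>1$ is such that $|B_R(0)\cap\Omega|>0$, and where $\nu$ is assumed unimodal if $\omega=\widehat\nu_R$. Define the trace operator $\operatorname{Tr}(u)=u|_{\Omega^c}$ on $W^p_\nu(\Omega|\mathbb{R}^d)$. Then: (i) $\ker(\operatorname{Tr})=W^p_{\nu,\Omega}(\Omega|\mathbb{R}^d)$ and $\operatorname{Tr}(W^p_\nu(\Omega|\mathbb{R}^d))=T^p_\nu(\Omega^c)$. (ii) The mappings $W^p_\nu(\Omega|\mathbb{R}^d)\xrightarrow{\operatorname{Tr}}T^p_\nu(\Omega^c)\xrightarrow{\operatorname{Id}}L^p(\Omega^c,\omega)$ are continuous. (iii) If $\Omega$ is bounded in one direction, then there is a bounded and continuous mapping $\operatorname{Ext}:T^p_\nu(\Omega^c)\to W^p_\nu(\Omega|\mathbb{R}^d)$ with $\operatorname{Tr}\circ\operatorname{Ext}=\operatorname{Id}$.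
   Context: Symmetric means $\nu(h)=\nu(-h)$; $a\wedge b=\min(a,b)$; $\Omega^c=\mathbb{R}^d\setminus\Omega$. $\nu$ is unimodal if it is radial and there is $c>0$ with $\nu(x)\ge c\,\nu(y)$ whenever $|x|\le|y|$. Weights: $$\widetilde\nu_\Omega(x)=\int_\Omega 1\wedge\nu(x-y)\,dy,\quad \overline\nu_\Omega(x)=\operatorname*{ess\,inf}_{y\in\Omega}\nu(x-y),\quad \widehat\nu_R(x)=\nu(R(1+|x|)).$$ $W^p_\nu(\Omega|\mathbb{R}^d)$ is the space of measurable $u:\mathbb{R}^d\to\mathbb{R}$ with $u|_\Omega\in L^p(\Omega)$ and $\int_\Omega\int_{\mathbb{R}^d}|u(x)-u(y)|^p\nu(x-y)\,dy\,dx<\infty$, with (semi)norm $\|u\|_{W^p_\nu(\Omega|\mathbb{R}^d)}=\big(\|u\|^p_{L^p(\Omega)}+\int_\Omega\int_{\mathbb{R}^d}|u(x)-u(y)|^p\nu(x-y)\,dy\,dx\big)^{1/p}$. $W^p_{\nu,\Omega}(\Omega|\mathbb{R}^d)=\{u\in W^p_\nu(\Omega|\mathbb{R}^d):u=0\text{ a.e. on }\Omega^c\}$. The trace space is $T^p_\nu(\Omega^c)=\{v:\Omega^c\to\mathbb{R}\text{ measurable}: v=u|_{\Omega^c}\text{ for some }u\in W^p_\nu(\Omega|\mathbb{R}^d)\}$ with $\|v\|_{T^p_\nu(\Omega^c)}=\inf\{\|u\|_{W^p_\nu(\Omega|\mathbb{R}^d)}:u\in W^p_\nu(\Omega|\mathbb{R}^d),\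 v=u|_{\Omega^c}\}$. $L^p(\Omega^c,\omega)$ has norm $(\int_{\Omega^c}|v|^p\omega\,dx)^{1/p}$. $\Omega$ is bounded in one direction if there are $R_0>0$ and $e\in\mathbb{R}^d$, $|e|=1$, with $\Omega\subset\{z\in\mathbb{R}^d:|z\cdot e|\le R_0\}$. *)

(* Defs.v *)
From HB Require Import structures.
From mathcomp Require Import all_boot all_order all_algebra.
From mathcomp Require Import all_classical all_reals all_analysis.
From mathcomp Require Import ess_sup_inf.
Import Order.TTheory GRing.Theory Num.Theory.
Import numFieldNormedType.Exports.

Set Implicit Arguments.
Unset Strict Implicit.
Unset Printing Implicit Defensive.

Local Open Scope classical_set_scope.
Local Open Scope ring_scope.

(* Lebesgue measure on R^(d+1): the outer measure given by countable covers
   by closed boxes, restricted to its Caratheodory-measurable (i.e. Lebesgue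
   measurable) sets. The dimension is d+1 so that it is positive. *)
Section lebesgue_outer_measure.
Variables (R : realType) (d : nat).
Implicit Types (a b : 'rV[R]_d.+1) (A : set 'rV[R]_d.+1)
  (F : nat -> 'rV[R]_d.+1 * 'rV[R]_d.+1).

Definition box a b : set 'rV[R]_d.+1 :=
  [set x | forall i, a 0 i <= x 0 i <= b 0 i].

(* 0 if a 0 i > b 0 i for some i, in which case the box is empty *)
Definition box_volume a b : R := \prod_i Num.max 0 (b 0 i - a 0 i).

Definition box_cover A : set (nat -> 'rV[R]_d.+1 * 'rV[R]_d.+1) :=
  [set F | A `<=` \bigcup_k box (F k).1 (F k).2].

Definition lebesgue_outer A : \bar R :=
  ereal_inf [set (\sum_(k <oo) (box_volume (F k).1 (F k).2)%:E)%E
            | F in box_cover A].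

Let vol (ab : 'rV[R]_d.+1 * 'rV[R]_d.+1) : \bar R := (box_volume ab.1 ab.2)%:E.

Let vol_ge0 ab : (0 <= vol ab)%E.
Proof. by rewrite lee_fin; apply: prodr_ge0 => i _; rewrite le_max lexx. Qed.

Let lebesgue_outer_ge0 A : (0 <= lebesgue_outer A)%E.
Proof.
apply: le_ereal_inf_tmp => _ [F _ <-].
by apply: nneseries_ge0 => n _ _; exact: vol_ge0.
Qed.

Let lebesgue_outer0 : lebesgue_outer set0 = 0%E.
Proof.
apply/eqP; rewrite eq_le lebesgue_outer_ge0 andbT.
apply: ereal_inf_lbound; exists (fun=> (0, 0)); first exact: sub0set.
apply: eseries0 => n _ _ /=; congr EFin.
by rewrite /box_volume big_ord_recl !mxE subrr maxxx mul0r.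
Qed.

Let le_lebesgue_outer : {homo lebesgue_outer : A B / A `<=` B >-> (A <= B)%E}.
Proof.
move=> A B AB; apply/ereal_inf_le_tmp => _ [F BF <-]; exists F => //.
exact: subset_trans BF.
Qed.

Local Open Scope ereal_scope.

Let lebesgue_outer_sigma_subadditive : sigma_subadditive lebesgue_outer.
Proof.
move=> A; have [[i ioo]|] := pselect (exists i, lebesgue_outer (A i) = +oo).
  rewrite (eseries_pinfty _ _ ioo) ?leey// => n _.
  by rewrite -ltNye (lt_le_trans _ (lebesgue_outer_ge0 _)).
rewrite -forallNE => Aoo.
suff add2e (e : {posnum R}) : lebesgue_outer (\bigcup_n A n) <=
    \sum_(i <oo) lebesgue_outer (A i) + e%:num%:E.
  by apply/lee_addgt0Pr => _/posnumP[].
rewrite (le_trans _ (epsilon_trick _ _ _))//.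
pose P n F := box_cover (A n) F /\ \sum_(k <oo) vol (F k) <=
  lebesgue_outer (A n) + (e%:num / (2 ^ n.+1)%:R)%:E.
have [G PG] : {G & forall n, P n (G n)}.
  apply: (@choice _ _ P) => n; rewrite /P /lebesgue_outer.
  set S := (X in ereal_inf X); move infS : (ereal_inf S) => iS.
  case: iS infS => [r Sr|Soo|Soo].
  - have en1 : (0 < e%:num / (2 ^ n.+1)%:R)%R by [].
    have /(lb_ereal_inf_adherent en1) : ereal_inf S \is a fin_num by rewrite Sr.
    by move=> [_ [F AF <-] xS]; exists F; split => //; rewrite -Sr; exact/ltW.
  - by have := Aoo n; rewrite /lebesgue_outer Soo.
  - by have := lebesgue_outer_ge0 (A n); rewrite /lebesgue_outer Soo.
pose H := uncurry G.
apply: (@le_trans _ _ (\esum_(i in setT) vol (H i))).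
  apply: ereal_inf_lbound => /=.
  have /card_esym/ppcard_eqP[f] := card_nat2.
  exists (H \o f).
    move=> t [i _ /(PG i).1[j _ Gijt]].
    by exists (f^-1%FUN (i, j)) => //=; rewrite invK ?inE.
  rewrite -(esum_pred_image (vol \o H) _ xpredT) ?[fun=> _]set_true//; first last.
    by move=> ? _; exact: vol_ge0.
  by rewrite image_eq.
rewrite (_ : esum _ _ = \sum_(i <oo) \sum_(j <oo) vol (G i j)); last first.
  pose J : nat -> set (nat * nat) := fun i => [set (i, j) | j in setT].
  rewrite (_ : setT = \bigcup_k J k); last first.
    by rewrite predeqE => -[a b]; split => // _; exists a => //; exists b.
  rewrite esum_bigcupT /=; last 2 first.
    - apply/trivIsetP => i j _ _ ij.
      rewrite predeqE => -[n m] /=; split => //= -[] [_] _ [<-{n} _].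
      by move=> [m' _] [] /esym/eqP; rewrite (negbTE ij).
    - by move=> ?; exact: vol_ge0.
  rewrite -(image_id [set: nat]) -fun_true esum_pred_image//; last first.
    by move=> n _; apply: esum_ge0 => ? _; exact: vol_ge0.
  apply: eq_eseriesr => /= j _.
  rewrite -(esum_pred_image (vol \o H) (pair j) predT)//=; last first.
    by move=> ? ? _ _; exact: (@can_inj _ _ _ snd).
  by congr esum; rewrite predeqE => -[a b]; split; move=> [i _ <-]; exists i.
apply: lee_nneseries => n *; last exact: (PG n).2.
by apply: nneseries_ge0 => m *; exact: vol_ge0.
Qed.

HB.instance Definition _ := isOuterMeasure.Build R 'rV[R]_d.+1 lebesgue_outer
  lebesgue_outer0 lebesgue_outer_ge0 le_lebesgue_outer
  lebesgue_outer_sigma_subadditive.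

End lebesgue_outer_measure.

(* R^(d+1) with its usual topology and the Lebesgue sigma-algebra. The norm
   `|x| inherited from 'rV is the sup norm; use enorm for the Euclidean one. *)
Definition eucl (R : realType) (d : nat) : Type := 'rV[R]_d.+1.

HB.instance Definition _ (R : realType) (d : nat) :=
  NormedModule.copy (eucl R d) 'rV[R]_d.+1.
HB.instance Definition _ (R : realType) (d : nat) :=
  Measurable.copy (eucl R d) (caratheodory_type (@lebesgue_outer R d)).

Definition leb (R : realType) (d : nat) : set (eucl R d) -> \bar R :=
  @lebesgue_outer R d.

HB.instance Definition _ (R : realType) (d : nat) :=
  isMeasure.Build _ (eucl R d) R (@leb R d)
    (@caratheodory_measure0 R 'rV[R]_d.+1 (@lebesgue_outer R d))
    (@caratheodory_measure_ge0 R 'rV[R]_d.+1 (@lebesgue_outer R d))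
    (@caratheodory_measure_sigma_additive R 'rV[R]_d.+1 (@lebesgue_outer R d)).

Section nonlocal_spaces.
Variables (R : realType) (d : nat).
Notation X := (eucl R d).
Notation mu := (@leb R d).
Implicit Types (x y z h : X) (Omega : set X) (u v f : X -> R) (nu : X -> R)
  (omega : X -> \bar R) (p r : R).

Definition edot x y : R := \sum_i x 0 i * y 0 i.
Definition enorm x : R := Num.sqrt (edot x x).
Definition eball r : set X := [set x | enorm x < r].

Definition bounded_in_one_direction Omega : Prop :=
  exists r0 : R, exists e : X,
    [/\ 0 < r0, enorm e = 1 & Omega `<=` [set z | `|edot z e| <= r0]].

(* A kernel nu is a function on R^(d+1) \ {0}; here it is a total function
   whose value at 0 is arbitrary and irrelevant. *)
Definition radial nu : Prop :=
  forall x y, x != 0 -> y != 0 -> enorm x = enorm y -> nu x = nu y.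

Definition unimodal nu : Prop :=
  radial nu /\
  exists c : R, 0 < c /\
    forall x y, x != 0 -> y != 0 -> enorm x <= enorm y -> c * nu y <= nu x.

Definition levy_kernel p nu : Prop :=
  [/\ measurable_fun (~` [set (0%R : X)]) nu,
      forall h, h != 0 -> 0 <= nu h,
      forall h, h != 0 -> nu (- h) = nu h &
      (\int[mu]_(h in ~` [set (0%R : X)])
         (Num.min 1 (enorm h `^ p) * nu h)%:E < +oo)%E].

Definition nu_tilde nu Omega x : \bar R :=
  (\int[mu]_(y in Omega) (Num.min 1 (nu (x - y)))%:E)%E.

(* essential infimum over Omega only: the integrand is +oo elsewhere *)
Definition nu_bar nu Omega x : \bar R :=
  ess_inf mu (patch (fun=> +oo%E) Omega (fun y => (nu (x - y))%:E)).

(* For radial nu, nu(s) with s > 0 is the value of nu at any vector of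
   Euclidean norm s; we take s times the first basis vector. *)
Definition nu_hat nu r x : \bar R :=
  (nu ((r * (1 + enorm x)) *: (delta_mx 0 0 : X)))%:E.

(* the p-th powers of the L^p(Omega) norm and of the nonlocal seminorm *)
Definition Lp_energy p Omega u : \bar R :=
  (\int[mu]_(x in Omega) (`|u x| `^ p)%:E)%E.

Definition nonlocal_energy p nu Omega u : \bar R :=
  (\int[mu]_(x in Omega) \int[mu]_y (`|u x - u y| `^ p * nu (x - y))%:E)%E.

Definition W_space p nu Omega : set (X -> R) :=
  [set u | [/\ measurable_fun setT u, (Lp_energy p Omega u < +oo)%E &
               (nonlocal_energy p nu Omega u < +oo)%E]].

Definition W_norm p nu Omega u : \bar R :=
  ((Lp_energy p Omega u + nonlocal_energy p nu Omega u) `^ p^-1)%E.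

Definition W0_space p nu Omega : set (X -> R) :=
  [set u | W_space p nu Omega u /\ ae_eq mu (~` Omega) u (cst 0)].

(* A function on the complement of Omega is represented by a total function
   whose values on Omega are irrelevant; such functions are identified when
   they are equal almost everywhere on the complement of Omega. *)
Definition trace Omega u : X -> R := patch (cst 0) (~` Omega) u.

Definition T_space p nu Omega : set (X -> R) :=
  [set v | measurable_fun (~` Omega) v /\
     exists2 u, W_space p nu Omega u & ae_eq mu (~` Omega) v u].

Definition T_norm p nu Omega v : \bar R :=
  ereal_inf [set W_norm p nu Omega u
            | u in [set u | W_space p nu Omega u /\ ae_eq mu (~` Omega) v u]].

Definition wLp_norm p omega Omega v : \bar R :=
  ((\int[mu]_(x in ~` Omega) ((`|v x| `^ p)%:E * omega x)) `^ p^-1)%E.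

Definition wLp_space p omega Omega : set (X -> R) :=
  [set v | measurable_fun (~` Omega) v /\ (wLp_norm p omega Omega v < +oo)%E].

(* the possibly nonlinear map Phi is continuous from A, with the topology of
   the seminorm N1, to B, with the topology of the seminorm N2 *)
Definition seminorm_continuous (A B : set (X -> R)) (N1 N2 : (X -> R) -> \bar R)
    (Phi : (X -> R) -> (X -> R)) : Prop :=
  (forall u, A u -> B (Phi u)) /\
  forall u, A u -> forall eps : R, 0 < eps ->
    exists2 delta : R, 0 < delta &
      forall u', A u' -> (N1 (u' \- u)%R < delta%:E)%E ->
        (N2 (Phi u' \- Phi u)%R < eps%:E)%E.

Definition seminorm_bounded (A : set (X -> R)) (N1 N2 : (X -> R) -> \bar R)
    (Phi : (X -> R) -> (X -> R)) : Prop :=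
  exists C : R, forall u, A u -> (N2 (Phi u) <= C%:E * N1 u)%E.

End nonlocal_spaces.

(* Main.v *)
From HB Require Import structures.
Require Import Defs.
From mathcomp Require Import all_boot all_order all_algebra.
From mathcomp Require Import all_classical all_reals all_analysis.
From mathcomp Require Import measurable_realfun ess_sup_inf.
From mathcomp Require Import ring lra.
Import Order.TTheory GRing.Theory Num.Theory.
Import numFieldNormedType.Exports.

(** Two facts carry the theorem: an estimate of weighted norms by the energy
    [Lp_energy + nonlocal_energy], and the uniform convexity of that energy.

    Weighted traces. For [x] in [Omega] and [y] outside,
    [`|u y| `^ p <= 2 * `|u x| `^ p + C * `|u x - u y| `^ p]. Multiply by
    [kap (x - y)], where [kap] is dominated by the kernel, and integrate over
    [x] in some [S] inside [Omega] and over [y] outside [Omega]. If the integral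
    of [kap (x - y)] over the [y] outside [Omega] is bounded uniformly in [x],
    the right-hand side is bounded by the energy of [u], and the left-hand side
    is the weighted norm of the trace for the weight
    [y |-> \int_(x in S) kap (x - y)] ([weighted_trace_le]). The truncated kernel
    on [S = Omega] gives [nu_tilde]. A multiple of the kernel on a box [K] of
    positive measure inside [Omega] and the ball of radius [r], at positive
    distance from the complement, gives a weight above [nu_bar] and, for unimodal
    kernels, above [nu_hat] ([admissible_weight_controlled]).

    Extension. A trace [v] is extended by the minimizer of the energy among all
    extensions ([min_ext]), whose norm is then the trace norm of [v]. Strict
    convexity of the p-th power is quantitative, by compactness and homogeneity
    ([powR_uniformly_convex]), and this integrates to uniform convexity of the
    energy: two extensions of [v] with almost minimal energy are close to each
    other ([near_minimizers_close]). Hence minimizing sequences are Cauchy; a fast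
    one converges almost everywhere, and Fatou's lemma makes the limit a
    minimizer ([minimizer_exists]). Continuity has the same source: if [w] is a
    small extension of [v' - v], then [min_ext v' - w] is an extension of [v]
    with almost minimal energy, hence it is close to [min_ext v].

    Measurability. Tonelli's theorem needs [nu (x - y)] to be measurable on the
    product space, which may fail for a Lebesgue measurable [nu]. The kernel
    is therefore replaced by a Borel function equal to it almost everywhere
    ([kernel_borel_version]); the reflection invariance of Lebesgue measure shows
    that this changes no inner integral. *)

Set Implicit Arguments.
Unset Strict Implicit.
Unset Printing Implicit Defensive.

Local Open Scope classical_set_scope.
Local Open Scope ring_scope.

(** * Inequalities for p-th powers of real numbers *)

Section powR_inequalities.
Variables (R : realType) (p : R).
Hypothesis p_gt1 : 1 < p.

Let p_gt0 : 0 < p. Proof. exact: lt_trans p_gt1. Qed.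

(** Young's inequality for [x * 1]. *)
Lemma bernoulli_powR (x : R) : 0 <= x -> 1 + p * (x - 1) <= x `^ p.
Proof.
move=> x0; have p1 : 0 < p - 1 by rewrite subr_gt0.
have q0 : 0 < p / (p - 1) by rewrite divr_gt0.
have := @conjugate_powR R x 1 p _ x0 ler01 p_gt0 q0.
rewrite invf_div powR1 mulr1 mul1r => /(_ _)/wrap[].
  by field; rewrite gt_eqF.
rewrite -(ler_pM2r p_gt0) mulrDl !mulfVK ?gt_eqF//; lra.
Qed.

(** Squaring the weak inequality at [Num.sqrt x] leaves the surplus
    [(p ^+ 2 - p) * (Num.sqrt x - 1) ^+ 2]. *)
Lemma bernoulli_powR_strict (x : R) :
  0 <= x -> x != 1 -> 1 + p * (x - 1) < x `^ p.
Proof.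
move=> x0 x1; set y := Num.sqrt x.
have y0 : 0 <= y by exact: sqrtr_ge0.
have xE : x = y ^+ 2 by rewrite sqr_sqrtr.
have y1 : y != 1 by apply: contra x1 => /eqP y1; rewrite xE y1 expr1n.
have -> : x `^ p = (y `^ p) ^+ 2.
  by rewrite -(powR_mulrn 2 (powR_ge0 y p)) powRAC powR_mulrn// -xE.
have := bernoulli_powR y0; set z := y `^ p => yz.
have z0 : 0 <= z by exact: powR_ge0.
have sq : 0 < (y - 1) ^+ 2 by rewrite exprn_even_gt0//= subr_eq0.
rewrite xE; have [h|h] := leP 0 (1 + p * (y - 1)).
  apply: (@lt_le_trans _ _ ((1 + p * (y - 1)) ^+ 2)); last by rewrite ler_pXn2r.
  rewrite -subr_gt0.
  have -> : (1 + p * (y - 1)) ^+ 2 - (1 + p * (y ^+ 2 - 1)) =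
    p * (p - 1) * (y - 1) ^+ 2 by ring.
  by rewrite pmulr_lgt0// mulr_gt0// subr_gt0.
apply: (@lt_le_trans _ _ 0); last exact: exprn_ge0.
have -> : 1 + p * (y ^+ 2 - 1) = 1 + p * (y - 1) * (y + 1) by ring.
have : (1 + p * (y - 1)) * (y + 1) < 0 by rewrite nmulr_rlt0// ltr_wpDl.
lra.
Qed.

(** Summing Bernoulli's inequality at [1 / s] and [`|t| / s], where
    [s = `|(1 + t) / 2|]. *)
Lemma powR_midpoint_strict (t : R) : t != 1 ->
  `|(1 + t) / 2| `^ p < (1 + `|t| `^ p) / 2.
Proof.
move=> t1; set s := `|(1 + t) / 2|.
have s0 : 0 <= s by exact: normr_ge0.
have sle : s <= (1 + `|t|) / 2.
  rewrite /s normrM (@ger0_norm _ 2^-1)// ler_pM2r//.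
  by rewrite (le_trans (ler_normD _ _))// normr1.
have t0 : 0 <= `|t| `^ p by exact: powR_ge0.
have [->|sn0] := eqVneq s 0; first by rewrite powR0 ?gt_eqF//; lra.
have sp : 0 < s by rewrite lt_neqAle eq_sym sn0.
have [s1|s1] := eqVneq s 1.
  rewrite s1 powR1.
  have t'1 : `|t| != 1.
    apply/eqP => tt; have [tp|tn] := leP 0 t.
      by move: tt t1; rewrite ger0_norm// => ->; rewrite eqxx.
    move: tt s1; rewrite /s ltr0_norm// => tt.
    by rewrite (_ : t = -1); [rewrite subrr mul0r normr0; lra|lra].
  have := bernoulli_powR_strict (normr_ge0 t) t'1.
  have : 0 <= p * (`|t| - 1) by rewrite mulr_ge0 ?(ltW p_gt0)//; lra.
  lra.
have i0 : 0 <= s^-1 by rewrite invr_ge0.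
have i1 : s^-1 != 1 by rewrite invr_eq1.
have := bernoulli_powR_strict i0 i1.
have := @bernoulli_powR (`|t| / s) (divr_ge0 (normr_ge0 _) s0).
rewrite powRM// (_ : s^-1 `^ p = (s `^ p)^-1); last first.
  by rewrite -[s^-1]powR_inv1// -powRrM mulN1r powRN.
set T := `|t| `^ p; set S := s `^ p.
have S0 : 0 < S by exact: powR_gt0.
move=> h1 h2; have h : 2 + p * ((1 + `|t|) / s - 2) < (1 + T) / S.
  have -> : 2 + p * ((1 + `|t|) / s - 2) =
    (1 + p * (`|t| / s - 1)) + (1 + p * (s^-1 - 1)) by ring.
  by rewrite [ltRHS]mulrDl mul1r; lra.
have h3 : 2 <= (1 + `|t|) / s by rewrite ler_pdivlMr//; lra.
have : 2 < (1 + T) / S.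
  apply: le_lt_trans h; rewrite lerDl mulr_ge0// ?subr_ge0//.
  exact: ltW.
by rewrite ltr_pdivlMr//; lra.
Qed.

(** At 0 the p-th power is squeezed below the norm itself. *)
Lemma continuous_normr_powR : continuous (fun t : R => `|t| `^ p).
Proof.
move=> t; have [->|t0] := eqVneq t 0.
  rewrite /continuous_at normr0 powR0 ?gt_eqF//.
  apply/cvgrPdist_lt => e e0; near=> x.
  rewrite sub0r normrN ger0_norm ?powR_ge0//.
  have x1 : `|x| < Num.min 1 e.
    near: x; apply/nbhs_ballP; exists (Num.min 1 e) => /=.
      by rewrite lt_min ltr01.
    by move=> y; rewrite /ball/= sub0r normrN.
  move: x1; rewrite lt_min => /andP[x1 xe].
  apply: le_lt_trans xe; have [->|x0] := eqVneq x 0.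
    by rewrite normr0 powR0 ?gt_eqF.
  rewrite -[leRHS]powRr1// ger_powR ?(ltW p_gt1)// normr_gt0 x0/=.
  exact: ltW.
suff : {for t, continuous ((fun u : R => u `^ p) \o (fun u : R => `|u|))} by [].
apply: continuous_comp.
  exact: norm_continuous.
apply/differentiable_continuous/derivable1_diffP/derivable_powR.
by rewrite in_itv/= normr_gt0 t0.
Unshelve. all: by end_near. Qed.

(** Along the segment the convexity gap is positive away from [t = 1], hence
    bounded below by compactness. *)
Let uconvex_unit (e : R) : 0 < e -> exists2 C, 0 < C &
  forall t, -1 <= t <= 1 -> `|1 - t| `^ p <=
    e * (1 + `|t| `^ p) + C * ((1 + `|t| `^ p) / 2 - `|(1 + t) / 2| `^ p).
Proof.
move=> e0; pose f t : R := (1 + `|t| `^ p) / 2 - `|(1 + t) / 2| `^ p.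
have cf : continuous f.
  move=> t; apply: (@cvgB _ R^o).
    apply: cvgM; last exact: cvg_cst.
    by apply: (@cvgD _ R^o); [exact: cvg_cst|exact: continuous_normr_powR].
  suff : {for t, continuous ((fun u : R => `|u| `^ p) \o
                             (fun u : R => (1 + u) / 2))} by [].
  apply: continuous_comp; last exact: continuous_normr_powR.
  apply: cvgM; last exact: cvg_cst.
  by apply: (@cvgD _ R^o); [exact: cvg_cst|exact: cvg_id].
have f0 t : 0 <= f t.
  have [->|t1] := eqVneq t 1.
    have h1 : (1 + 1) / 2 = 1 :> R by lra.
    by rewrite /f normr1 powR1 h1 normr1 powR1 subrr.
  by rewrite subr_ge0 ltW// powR_midpoint_strict.
pose h := Num.min 1 (e `^ p^-1).
have h0 : 0 < h by rewrite lt_min ltr01 powR_gt0.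
have h1 : h <= 1 by rewrite ge_min lexx.
have [||c] := @EVT_min R f (-1) (1 - h).
- lra.
- exact: continuous_subspaceT.
rewrite in_itv/= => /andP[_ ch] fmin.
have fc0 : 0 < f c.
  by rewrite subr_gt0 powR_midpoint_strict// lt_eqF// (le_lt_trans ch)// gtrBl.
exists (2 `^ p / f c) => [|t /andP[t1 t2]].
  by rewrite divr_gt0 ?powR_gt0.
have s0 : 0 <= 1 - t by rewrite subr_ge0.
rewrite -/(f t) (ger0_norm s0).
have C0 : 0 <= 2 `^ p / f c by rewrite divr_ge0 ?powR_ge0// ltW.
have [th|th] := leP t (1 - h).
  have := fmin t; rewrite in_itv/= t1 th => /(_ isT) ft.
  apply: (@le_trans _ _ (2 `^ p)).
    by apply: ge0_ler_powR; rewrite ?nnegrE ?(ltW p_gt0)//; lra.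
  rewrite -[leLHS]add0r lerD//.
    by rewrite mulr_ge0 ?addr_ge0 ?powR_ge0// ltW.
  by rewrite -mulrA ler_peMr ?powR_ge0// mulrC ler_pdivlMr// mul1r.
rewrite -[leLHS]addr0; apply: lerD; last exact: mulr_ge0.
apply: (@le_trans _ _ e); last first.
  by rewrite ler_peMr ?(ltW e0)// lerDl powR_ge0.
have he : 1 - t <= e `^ p^-1.
  by rewrite (@le_trans _ _ h)// ?ge_min ?lexx ?orbT//; lra.
have -> : e = (e `^ p^-1) `^ p by rewrite -powRrM mulVf ?gt_eqF// powRr1// ltW.
by apply: ge0_ler_powR; rewrite ?nnegrE ?powR_ge0// ltW.
Qed.

(** The quantitative form of strict convexity that, once integrated, makes the
    energy uniformly convex for every exponent above 1. Homogeneity reduces it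
    to one point being 1 and the other lying in the unit interval. *)
Lemma powR_uniformly_convex (e : R) : 0 < e -> exists2 C, 0 < C &
  forall a b : R, `|a - b| `^ p <= e * (`|a| `^ p + `|b| `^ p) +
    C * ((`|a| `^ p + `|b| `^ p) / 2 - `|(a + b) / 2| `^ p).
Proof.
move=> e0; have [C C0 HC] := uconvex_unit e0; exists C => // a b.
wlog ba : a b / `|b| <= `|a|.
  move=> H; have [|/ltW] := leP `|b| `|a|; first exact: H.
  by move=> /H; rewrite distrC (addrC b) (addrC (_ `^ _)).
have [a0|a0] := eqVneq a 0.
  move: ba; rewrite a0 normr0 normr_le0 => /eqP ->.
  by rewrite subrr addr0 mul0r normr0 powR0 ?gt_eqF// addr0 mul0r subrr !mulr0 addr0.
have [t bE] : exists t, b = a * t by exists (b / a); rewrite mulrC divfK.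
have /HC : -1 <= t <= 1.
  by rewrite -ler_norml; move: ba; rewrite bE normrM ger_pMr ?normr_gt0.
have ap : 0 <= `|a| `^ p by exact: powR_ge0.
move=> /(ler_wpM2l ap).
have -> : a - b = a * (1 - t) by rewrite mulrBr mulr1 bE.
have -> : (a + b) / 2 = a * ((1 + t) / 2) by rewrite bE mulrA mulrDr mulr1.
rewrite bE (normrM a t) (normrM a (1 - t)) (normrM a ((1 + t) / 2)).
rewrite !powRM ?normr_ge0// => /le_trans; apply.
by rewrite le_eqVlt; apply/orP; left; apply/eqP; ring.
Qed.

(** Either [b] is small relative to [a], or [a] is controlled by [b]. *)
Lemma powR_normD_le (e : R) : 0 < e -> exists2 C, 0 <= C &
  forall a b : R, `|a + b| `^ p <= (1 + e) * `|a| `^ p + C * `|b| `^ p.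
Proof.
move=> e0; have e1 : 1 < 1 + e by rewrite ltrDl.
have [s [s0 sE]] : exists s, 0 < s /\ 1 + e = (1 + s) `^ p.
  exists ((1 + e) `^ p^-1 - 1); split; last first.
    by rewrite subrKC -powRrM mulVf ?gt_eqF// powRr1// ltW// (lt_trans _ e1).
  rewrite subr_gt0; apply: (@le_lt_trans _ _ (1 `^ p^-1)).
    by rewrite powR1.
  apply: gt0_ltr_powR; rewrite ?invr_gt0 ?nnegrE//.
  by rewrite ltW// (lt_trans _ e1).
have s1 : 0 <= 1 + s by rewrite addr_ge0// ltW.
have si1 : 0 <= 1 + s^-1 by rewrite addr_ge0// invr_ge0 ltW.
exists ((1 + s^-1) `^ p) => [|a b]; first exact: powR_ge0.
(* [1 + s] is the p-th root of [1 + e], which absorbs [b] into [a]. *)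
have [ba|ba] := leP `|b| (s * `|a|).
  rewrite -[leLHS]addr0 lerD ?mulr_ge0 ?powR_ge0//.
  rewrite sE -powRM//; apply: ge0_ler_powR; rewrite ?nnegrE ?(ltW p_gt0) ?mulr_ge0//.
  by rewrite (le_trans (ler_normD _ _))// mulrDl mul1r lerD2l.
rewrite -[leLHS]add0r lerD//; first by rewrite sE mulr_ge0 ?powR_ge0.
rewrite -powRM//; apply: ge0_ler_powR; rewrite ?nnegrE ?(ltW p_gt0) ?mulr_ge0//.
rewrite (le_trans (ler_normD _ _))// mulrDl mul1r addrC lerD2l.
by rewrite mulrC ler_pdivlMr// mulrC ltW.
Qed.

End powR_inequalities.

(** * Lebesgue measure, its invariance, and Borel versions of functions *)

Section lebesgue_measurability.
Variables (R : realType) (d : nat).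
Notation X := (eucl R d).
Notation mu := (@leb R d).
Implicit Types (a b x y : X) (A : set X).

Lemma leb_le_cover A (F : nat -> X * X) :
  A `<=` \bigcup_k box (F k).1 (F k).2 ->
  (mu A <= \sum_(k <oo) (box_volume (F k).1 (F k).2)%:E)%E.
Proof. by move=> AF; apply: ereal_inf_lbound; exists F. Qed.

Lemma le_leb A B : A `<=` B -> (mu A <= mu B)%E.
Proof. exact: le_outer_measure. Qed.

Lemma box_volume_ge0 a b : 0 <= box_volume a b.
Proof. by apply: prodr_ge0 => i _; rewrite le_max lexx. Qed.

Definition set_coord x i (c : R) : X := \row_j (if j == i then c else x 0 j).

Lemma box_volume_set_coord a b i (s t : R) :
  box_volume (set_coord a i s) (set_coord b i t) =
  Num.max 0 (t - s) * \prod_(j | j != i) Num.max 0 (b 0 j - a 0 j).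
Proof.
rewrite /box_volume (bigD1 i)//= !mxE eqxx; congr (_ * _).
by apply: eq_bigr => j ji; rewrite !mxE (negbTE ji).
Qed.

Lemma box_volume_split a b i (c : R) :
  box_volume a b = box_volume a (set_coord b i (Num.min (b 0 i) c)) +
                   box_volume (set_coord a i (Num.max (a 0 i) c)) b.
Proof.
have idc x : set_coord x i (x 0 i) = x.
  by apply/rowP => j; rewrite mxE; case: eqP => // ->.
rewrite -{1 2}(idc a) -{1 4}(idc b) !box_volume_set_coord -mulrDl.
by congr (_ * _); rewrite /Num.min /Num.max; do !case: ifPn; lra.
Qed.

(** Cutting each box of a cover along the hyperplane yields covers of the two
    parts with the same total volume. *)
Lemma measurable_halfspace i (c : R) : measurable [set x : X | x 0 i <= c].
Proof.
apply: (@le_caratheodory_measurable _ _ (@lebesgue_outer R d)) => A.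
apply: le_ereal_inf_tmp => _ [F AF <-].
pose F1 k : X * X := ((F k).1, set_coord (F k).2 i (Num.min ((F k).2 0 i) c)).
pose F2 k : X * X := (set_coord (F k).1 i (Num.max ((F k).1 0 i) c), (F k).2).
apply: (@le_trans _ _ (\sum_(k <oo) (box_volume (F1 k).1 (F1 k).2)%:E +
                       \sum_(k <oo) (box_volume (F2 k).1 (F2 k).2)%:E)%E).
  apply: leeD; apply: leb_le_cover => x [/AF[k _ Fkx]] /= xc; exists k => //= j.
    have /andP[ax xb] := Fkx j.
    by rewrite mxE ax /=; case: eqP => // ->; rewrite le_min xc andbT; case/andP: (Fkx i).
  have /andP[ax xb] := Fkx j; move/negP : xc; rewrite -ltNge => /ltW xc.
  rewrite mxE xb andbT; case: eqP => // ->; rewrite ge_max xc andbT.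
  by case/andP: (Fkx i).
rewrite -nneseriesD; last 2 first.
- by move=> k _; rewrite lee_fin box_volume_ge0.
- by move=> k _; rewrite lee_fin box_volume_ge0.
apply: lee_nneseries => k _; first by rewrite lee_fin addr_ge0// box_volume_ge0.
by rewrite lee_fin (box_volume_split (F k).1 (F k).2 i c).
Qed.

Lemma measurable_coord i : measurable_fun setT (fun x : X => x 0 i).
Proof.
apply: (measurability _ (measurable_realfun.RGenOInfty.measurableE R)) => _ [_ [c ->] <-].
rewrite setTI (_ : _ @^-1` _ = ~` [set x : X | x 0 i <= c]).
  exact/measurableC/measurable_halfspace.
by apply/seteqP; split => x /=; rewrite in_itv/= andbT ltNge => /negP.
Qed.

(** The Borel sets, presented by the generators that make a map into them
    measurable as soon as its coordinates are. *)
Definition coord_sets : set (set X) :=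
  [set A | exists i (B : set R), measurable B /\ A = (fun x : X => x 0 i) @^-1` B].
Definition borel_eucl := g_sigma_algebraType coord_sets.

Lemma measurable_into_borel d' (T : measurableType d') (f : T -> borel_eucl) :
  (forall i, measurable_fun setT (fun t => (f t : X) 0 i)) ->
  measurable_fun setT f.
Proof.
move=> mf.
apply: (@measurability _ _ T borel_eucl setT f coord_sets erefl).
move=> _ [_ [i [B [mB ->]]] <-]; have := mf i measurableT B mB.
by rewrite !setTI.
Qed.

Lemma measurable_borel_coord i :
  measurable_fun setT (fun x : borel_eucl => (x : X) 0 i).
Proof.
move=> _ B mB; rewrite setTI; apply: sub_sigma_algebra.
by exists i, B.
Qed.

Lemma borel_measurable A : measurable (A : set borel_eucl) -> measurable A.
Proof.
have : measurable_fun setT (id : X -> borel_eucl).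
  by apply: measurable_into_borel => i; exact: measurable_coord.
by move=> /(_ measurableT A)/[apply]; rewrite setTI.
Qed.

Lemma borel_box a b : measurable (box a b : set borel_eucl).
Proof.
rewrite (_ : box a b = \bigcap_(i in [set: 'I_d.+1])
   ((fun x : borel_eucl => (x : X) 0 i) @^-1` `[a 0 i, b 0 i])); last first.
  apply/seteqP; split => x /= xab i; first by move=> _; rewrite /= in_itv/=; exact: xab.
  by have := xab i I; rewrite /= in_itv.
apply: fin_bigcap_measurable; first exact: finite_finset.
by move=> i _; rewrite -[X in measurable X]setTI; exact: measurable_borel_coord.
Qed.

Lemma measurable_box a b : measurable (box a b : set X).
Proof. by apply: borel_measurable; exact: borel_box. Qed.

Lemma leb_box a b : (mu (box a b) <= (box_volume a b)%:E)%E.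
Proof.
pose F k : X * X := if k is 0%N then (a, b) else (0, 0).
apply: le_trans (@leb_le_cover _ F _) _; first by move=> x abx; exists 0%N.
rewrite (nneseries_split 0 1)//= => [|k _]; last first.
  by rewrite lee_fin box_volume_ge0.
rewrite add0n big_nat1/= eseries0 ?adde0// => -[|k]//= _ _.
by rewrite /box_volume big_ord_recl !mxE subrr maxxx mul0r.
Qed.

Lemma leb_sigma_finite : sigma_finite setT mu.
Proof.
exists (fun n : nat => box (const_mx (- n%:R) : X) (const_mx n%:R)).
  apply/esym/seteqP; split => // x _.
  pose M : R := \sum_i `|x 0 i|; exists (Num.truncn M).+1 => //= i.
  rewrite !mxE -ler_norml (@le_trans _ _ M)//.
    by rewrite /M (bigD1 i)//= lerDl sumr_ge0.
  by rewrite ltW// truncnS_gt.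
move=> n; split; first exact: measurable_box.
exact: le_lt_trans (leb_box _ _) (ltry _).
Qed.

HB.instance Definition _ :=
  Measure_isSigmaFinite.Build _ X R mu leb_sigma_finite.

Let leb_reflect_le A x : (mu ((fun y => (x - y)%R) @^-1` A) <= mu A)%E.
Proof.
apply: le_ereal_inf_tmp => _ [F AF <-].
pose G k : X * X := (x - (F k).2, x - (F k).1).
rewrite [leRHS](_ : _ = \sum_(k <oo) (box_volume (G k).1 (G k).2)%:E)%E.
  apply: leb_le_cover => y /AF [k _ Fky]; exists k => //= i.
  by have := Fky i; rewrite !mxE => /andP[h1 h2]; apply/andP; split; lra.
apply: eq_eseriesr => k _; congr EFin; apply: eq_bigr => i _.
by rewrite !mxE; congr Num.max; ring.
Qed.

(** Boxes of a cover are mapped to boxes of the same volume. *)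
Lemma leb_reflect A x : mu ((fun y => x - y) @^-1` A) = mu A.
Proof.
apply/eqP; rewrite eq_le leb_reflect_le/=.
rewrite -{1}(_ : (fun y => x - y) @^-1` ((fun y => x - y) @^-1` A) = A).
  exact: leb_reflect_le.
by apply/seteqP; split => y /=; rewrite subKr.
Qed.

Lemma measurable_reflect x : measurable_fun setT (fun y : X => x - y).
Proof.
move=> _ A mA; rewrite setTI.
have cA (B : set X) : mu B = (mu (B `&` A) + mu (B `&` ~` A))%E := mA B.
suff cB (B : set X) : mu B = (mu (B `&` (fun y => (x - y)%R) @^-1` A) +
                              mu (B `&` ~` ((fun y => (x - y)%R) @^-1` A)))%E.
  exact: cB.
rewrite -(leb_reflect B x) cA; congr (_ + _)%E; rewrite -[RHS](leb_reflect _ x);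
  by congr leb; apply/seteqP; split => y /=; rewrite subKr.
Qed.

Lemma integral_reflect (f : X -> \bar R) x : measurable_fun setT f ->
  (forall y, 0 <= f y)%E -> (\int[mu]_y f (x - y)%R = \int[mu]_y f y)%E.
Proof.
move=> mf f0; have mphi := measurable_reflect x.
have := @ge0_integral_pushforward _ _ X X R _ mphi mu setT f measurableT mf
  (fun y _ => f0 y).
rewrite preimage_setT => <-; apply: eq_measure_integral => A mA _.
exact: leb_reflect.
Qed.

(** Covers by boxes at distance 1/(n+1) of being optimal, intersected over n. *)
Lemma borel_hull A : exists B : set X,
  [/\ measurable (B : set borel_eucl), A `<=` B & (mu B <= mu A)%E].
Proof.
have [Aoo|Afin] := eqVneq (mu A) +oo%E.
  by exists setT; split => //; rewrite Aoo leey.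
have Afn : mu A \is a fin_num.
  by rewrite ge0_fin_numE ?ltey//; exact: outer_measure_ge0.
have [F FP] : {F : nat -> nat -> X * X & forall n,
    A `<=` \bigcup_k box (F n k).1 (F n k).2 /\
    (\sum_(k <oo) (box_volume (F n k).1 (F n k).2)%:E <=
      mu A + n.+1%:R^-1%:E)%E}.
  apply: (@choice _ _ (fun n F => A `<=` \bigcup_k box (F k).1 (F k).2 /\
    (\sum_(k <oo) (box_volume (F k).1 (F k).2)%:E <=
      mu A + n.+1%:R^-1%:E)%E)) => n.
  have n0 : 0 < n.+1%:R^-1 :> R by rewrite invr_gt0.
  have [_ [F AF <-] Flt] := lb_ereal_inf_adherent n0 Afn.
  by exists F; split => //; exact: ltW.
exists (\bigcap_n \bigcup_k box (F n k).1 (F n k).2); split.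
- by apply: bigcapT_measurable => n; apply: bigcupT_measurable => k; exact: borel_box.
- by move=> x Ax n _; exact: (FP n).1.
apply/lee_addgt0Pr => e e0.
have [n ne] : exists n, n.+1%:R^-1 < e.
  exists (Num.truncn e^-1); rewrite invf_plt ?posrE//; exact: truncnS_gt.
apply: (@le_trans _ _ (mu A + n.+1%:R^-1%:E)%E); last by rewrite leeD2l// lee_fin ltW.
apply: le_trans (FP n).2; apply: leb_le_cover => x; exact.
Qed.

(** Hulls of the pieces of finite measure exceed them by null sets. *)
Lemma borel_hull_null A : measurable A -> exists B : set X,
  [/\ measurable (B : set borel_eucl), A `<=` B & mu.-negligible (B `\` A)].
Proof.
move=> mA; have [C CT CP] := leb_sigma_finite.
have [B BP] := choice (fun n => borel_hull (A `&` C n)).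
exists (\bigcup_n B n); split.
- by apply: bigcupT_measurable => n; have [] := BP n.
- move=> x Ax; have [n _ Cx] : (\bigcup_n C n) x by rewrite -CT.
  by exists n => //; have [_ + _] := BP n; exact.
apply: (@negligibleS _ _ _ _ (\bigcup_n (B n `\` (A `&` C n)))).
  by move=> x [[n _ Bx] Ax]; exists n => //; split => // -[].
apply: negligible_bigcup => n; have [/borel_measurable mB AB muB] := BP n.
have [mC Coo] := CP n; have mAC := measurableI _ _ mA mC.
apply/negligibleP; first exact: measurableD.
have ACoo : (mu (A `&` C n) < +oo)%E.
  by rewrite (le_lt_trans _ Coo)// le_leb//; exact: subIsetr.
have ACfin : mu (A `&` C n) \is a fin_num by rewrite ge0_fin_numE.
rewrite measureD//; last exact: le_lt_trans ACoo.
rewrite (setIidr AB); have muE : mu (B n) = mu (A `&` C n).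
  by apply/eqP; rewrite eq_le muB le_leb.
exact: etrans (congr1 (fun t => t - mu (A `&` C n))%E muE) (subee ACfin).
Qed.

(** The witness at [x] is the supremum of the rationals [q] such that the Borel
    hull of [set x | q <= f x] contains [x]; off the null sets by which the hulls
    are too large, this is [f x]. *)
Lemma borel_version (f : X -> R) : measurable_fun setT f ->
  (forall x, 0 <= f x) -> exists g : borel_eucl -> R,
  [/\ measurable_fun setT g, forall x, 0 <= g x & {ae mu, forall x, f x = g x}].
Proof.
move=> mf f0; have mA (q : rat) : measurable [set x | ratr q <= f x].
  rewrite -[X in measurable X]setTI.
  have := mf measurableT `[ratr q, +oo[%classic (measurable_itv _).
  by congr (measurable (_ `&` _)); apply/seteqP; split => x /=; rewrite in_itv/= andbT.
have [B BP] := choice (fun q => borel_hull_null (mA q)).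
pose g0 (x : borel_eucl) : \bar R := ereal_sup [set (ratr q)%:E | q in [set q | B q x]].
have mg0 : measurable_fun setT g0.
  apply: (measurability _ (ErealGenOInfty.measurableE R)) => _ [_ [c ->] <-].
  rewrite setTI (_ : _ @^-1` _ =
      \bigcup_(q in [set q | c < ratr q]) B q); last first.
    apply/seteqP; split => x /=; rewrite in_itv/= andbT.
      by move=> /ereal_sup_gt[_ [q Bq <-]]; rewrite lte_fin => cq; exists q.
    move=> [q /= cq Bq]; apply: (@lt_le_trans _ _ (ratr q)%:E).
      by rewrite lte_fin.
    by apply: ereal_sup_ubound; exists q.
  rewrite bigcup_mkcond; apply: bigcupT_measurable_rat => q.
  by case: ifP => // _; have [] := BP q.
exists (fine \o g0); split.
- exact: measurableT_comp.
- move=> x; apply: fine_ge0; apply: ereal_sup_ubound; exists 0; last by rewrite rmorph0.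
  have [_ + _] := BP 0; apply; rewrite /= rmorph0; exact: f0.
apply: (@negligibleS _ _ _ _ (\bigcup_(n : nat)
    (if unpickle n is Some q then B q `\` [set x | ratr q <= f x] else set0))).
  move=> x /= fg; apply: contrapT => nx; apply: fg.
  have Bx q : B q x -> ratr q <= f x.
    move=> Bqx; apply: contrapT => qf; apply: nx; exists (pickle q); first exact: I.
    by rewrite pickleK; split.
  have Bx' q : ratr q <= f x -> B q x by have [_ + _] := BP q; exact.
  suff -> : g0 x = (f x)%:E by [].
  apply/eqP; rewrite eq_le; apply/andP; split.
    by apply: ge_ereal_sup => _ [q Bq <-]; rewrite lee_fin Bx.
  apply/lee_subgt0Pr => e e0.
  have /rat_in_itvoo[q] : f x - e < f x by rewrite ltrBlDr ltrDl.
  rewrite in_itv/= => /andP[eq qf]; apply: (@le_trans _ _ (ratr q)%:E).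
    by rewrite -EFinB lee_fin ltW.
  by apply: ereal_sup_ubound; exists q => //; apply: Bx'; exact: ltW.
apply: negligible_bigcup => n; case: unpickle => [q|]; last exact: negligible_set0.
by have [] := BP q.
Qed.

(** Subtraction is measurable only into the Borel sets: the preimage of a
    Lebesgue null set need not be in the product of the Lebesgue sigma-algebras. *)
Lemma measurable_sub : measurable_fun setT (fun z : X * X => z.1 - z.2 : borel_eucl).
Proof.
apply: measurable_into_borel => i.
rewrite (_ : (fun _ => _) = (fun z : X * X => z.1 0 i - z.2 0 i)).
  by apply: measurable_funB; apply: (measurableT_comp (measurable_coord i)).
by apply/funext => z; rewrite !mxE.
Qed.

End lebesgue_measurability.

(** * The Euclidean norm and open sets *)

Section euclidean_norm.
Variables (R : realType) (d : nat).
Notation X := (eucl R d).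
Notation mu := (@leb R d).
Implicit Types (x y : X).

Lemma edot_ge0 x : 0 <= edot x x.
Proof. by apply: sumr_ge0 => i _; rewrite -expr2 sqr_ge0. Qed.

Lemma enorm_ge0 x : 0 <= enorm x.
Proof. exact: sqrtr_ge0. Qed.

Lemma sqr_enorm x : enorm x ^+ 2 = edot x x.
Proof. by rewrite sqr_sqrtr// edot_ge0. Qed.

Lemma coord_le_enorm x i : `|x 0 i| <= enorm x.
Proof.
rewrite -sqrtr_sqr ler_sqrt ?edot_ge0// /edot (bigD1 i)//= -expr2 lerDl.
by apply: sumr_ge0 => j _; rewrite -expr2 sqr_ge0.
Qed.

Lemma enorm_eq0 x : (enorm x == 0) = (x == 0).
Proof.
apply/idP/idP => [/eqP x0|/eqP ->]; last first.
  rewrite /enorm /edot big1 ?sqrtr0// => i _; by rewrite mxE mul0r.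
apply/eqP/rowP => i; apply/eqP; rewrite mxE -normr_le0 -x0.
exact: coord_le_enorm.
Qed.

Lemma enorm_gt0 x : (0 < enorm x) = (x != 0).
Proof. by rewrite lt_neqAle enorm_ge0 andbT eq_sym enorm_eq0. Qed.

Lemma enormN x : enorm (- x) = enorm x.
Proof. by congr Num.sqrt; apply: eq_bigr => i _; rewrite mxE mulrNN. Qed.

Lemma edot_le_enorm x y : edot x y <= enorm x * enorm y.
Proof.
have [->|x0] := eqVneq x 0.
  by rewrite /edot big1 ?mulr_ge0 ?enorm_ge0// => i _; rewrite mxE mul0r.
have [->|y0] := eqVneq y 0.
  by rewrite /edot big1 ?mulr_ge0 ?enorm_ge0// => i _; rewrite mxE mulr0.
(* This vector vanishes in the equality case of Cauchy-Schwarz. *)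
have := edot_ge0 (enorm y *: x - enorm x *: y : X).
have -> : edot (enorm y *: x - enorm x *: y : X) (enorm y *: x - enorm x *: y) =
    enorm y ^+ 2 * edot x x + enorm x ^+ 2 * edot y y -
    2 * (enorm x * enorm y) * edot x y.
  rewrite /edot !mulr_sumr -big_split/= -sumrB; apply: eq_bigr => i _.
  by rewrite !mxE; ring.
rewrite -!sqr_enorm => h.
have e0 : 0 < 2 * (enorm x * enorm y) by rewrite !mulr_gt0// enorm_gt0.
rewrite -(ler_pM2l e0) -subr_ge0; apply: le_trans h _.
by rewrite le_eqVlt; apply/orP; left; apply/eqP; ring.
Qed.

Lemma enormD_le x y : enorm (x + y) <= enorm x + enorm y.
Proof.
rewrite -(@ler_pXn2r _ 2)// ?nnegrE ?addr_ge0 ?enorm_ge0// sqrrD !sqr_enorm.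
have -> : edot (x + y) (x + y) = edot x x + edot x y *+ 2 + edot y y.
  rewrite /edot -mulr_natl mulr_sumr -!big_split/=.
  by apply: eq_bigr => i _; rewrite !mxE; ring.
by rewrite lerD2r lerD2l lerMn2r edot_le_enorm.
Qed.

Lemma enorm_axis (c : R) : enorm (c *: (delta_mx 0 0 : X)) = `|c|.
Proof.
rewrite /enorm /edot big_ord_recl big1 => [|i _]; last first.
  by rewrite !mxE/= mulr0 mul0r.
by rewrite !mxE !eqxx/= mulr1 addr0 -expr2 sqrtr_sqr.
Qed.

Lemma measurable_enorm : measurable_fun setT (@enorm R d).
Proof.
apply: measurableT_comp.
  by apply: continuous_measurable_fun; exact: sqrt_continuous.
apply: measurable_sum => i; apply: measurable_funM; exact: measurable_coord.
Qed.

Lemma measurable_eball r : measurable (@eball R d r).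
Proof.
have := measurable_enorm measurableT (@measurable_itv R `]-oo, r[).
by rewrite setTI; congr measurable; apply/seteqP; split => x /=; rewrite in_itv.
Qed.

(** Open sets are exhausted by countably many boxes with rational centers whose
    concentric doubles remain inside; doubling leaves room to the complement. *)
Lemma open_separated_boxes (U : set X) : open U ->
  exists (K : nat -> set X) (delta : nat -> R), U = \bigcup_k K k /\
  forall k, [/\ 0 < delta k, measurable (K k), (mu (K k) < +oo)%E &
    forall x y, K k x -> ~ U y -> delta k <= enorm (x - y)].
Proof.
move=> Uop; pose J := ('rV[rat]_d.+1 * nat)%type.
pose c (an : J) : X := map_mx ratr an.1.
pose e (an : J) : R := an.2.+1%:R^-1.
pose B (t : R) (an : J) : set X :=
  box (c an - const_mx (t * e an)) (c an + const_mx (t * e an)).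
have e0 an : 0 < e an by rewrite invr_gt0.
pose K k := if unpickle k is Some an
  then (if `[< B 2 an `<=` U >] then B 1 an else set0) else set0.
pose delta k := if unpickle k is Some an then e an else 1.
exists K, delta; split.
- apply/seteqP; split => x; last first.
    move=> [k _]; rewrite /K; case: unpickle => // an; case: asboolP => // BU Bx.
    apply: BU => i; have := Bx i; rewrite !mxE; have := e0 an; lra.
  move=> Ux; have /nbhs_ballP[eps/= eps0 xU] : nbhs x U by exact: open_nbhs_nbhs.
  have [n ne] : exists n : nat, 3 * n.+1%:R^-1 < eps.
    exists (Num.truncn (eps / 3)^-1); rewrite mulrC -ltr_pdivlMr//.
    by rewrite invf_plt ?posrE ?divr_gt0//; exact: truncnS_gt.
  have n0 : 0 < n.+1%:R^-1 :> R by rewrite invr_gt0.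
  have /choice[a aP] : forall i : 'I_d.+1, exists q : rat,
      `|x 0 i - ratr q| < n.+1%:R^-1.
    move=> i; have /rat_in_itvoo[q] : x 0 i - n.+1%:R^-1 < x 0 i + n.+1%:R^-1.
      by rewrite ltrD2l gtrN.
    by rewrite in_itv/= => xq; exists q; rewrite distrC ltr_distl.
  pose an : J := (\row_i a i, n).
  have {}aP i : `|x 0 i - ratr (a i)| < e an := aP i.
  have {}ne : 3 * e an < eps := ne.
  exists (pickle an); first exact: I.
  rewrite /K pickleK; case: asboolP => [_ i|[]].
    have := aP i; rewrite !mxE mul1r ltr_distl => /andP[h1 h2].
    by rewrite !ltW.
  move=> y By; apply: xU; split => // i0 i; rewrite ord1.
  have := By i; have := aP i; rewrite !mxE /ball/= !ltr_distl.
  move=> /andP[h1 h2] /andP[h3 h4]; apply/andP; split; lra.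
- move=> k; rewrite /delta /K; case: unpickle => [an|]; last first.
    by split => //; rewrite measure0.
  case: asboolP => BU; last by split => //; rewrite measure0.
  split=> //; first exact: measurable_box.
    exact: le_lt_trans (leb_box _ _) (ltry _).
  move=> x y Bx Uy; have : ~ B 2 an y by move=> /BU.
  move=> /existsNP[i]; have := Bx i; rewrite !mxE => /andP[h1 h2] /negP h3.
  apply: le_trans (coord_le_enorm _ i); rewrite !mxE.
  rewrite ler_normr; move: h3; rewrite negb_and -!ltNge => /orP[h3|h3].
    by apply/orP; left; have := e0 an; lra.
  by apply/orP; right; have := e0 an; lra.
Qed.

Lemma measurable_open (U : set X) : open U -> measurable U.
Proof.
move=> /open_separated_boxes[K [delta [-> KP]]].
by apply: bigcupT_measurable => k; have [] := KP k.
Qed.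

(** One of the boxes exhausting [U] meets [A] in positive measure. *)
Lemma open_positive_separated (U A : set X) : open U -> measurable A ->
  (0 < mu (A `&` U))%E -> exists (K : set X) (delta : R),
  [/\ 0 < delta, measurable K, (0 < mu K < +oo)%E, K `<=` A `&` U &
    forall x y, K x -> ~ U y -> delta <= enorm (x - y)].
Proof.
move=> Uop mA AU; have [K [delta [UE KP]]] := open_separated_boxes Uop.
have mAK k : measurable (A `&` K k) by apply: measurableI => //; have [] := KP k.
have [k Kk] : exists k, (0 < mu (A `&` K k))%E.
  apply: contrapT => /forallNP K0; move: AU; apply/negP; rewrite -leNgt.
  have : mu.-negligible (A `&` U).
    rewrite UE setI_bigcupr; apply: negligible_bigcup => k.
    apply/negligibleP => //; apply/eqP; rewrite -measure_le0 leNgt.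
    exact/negP/K0.
  move=> /measure_negligible h; rewrite -[X in (X <= _)%E]/(mu (A `&` U)) h//.
  exact/measurableI/measurable_open.
have [d0 mK Koo Kd] := KP k; exists (A `&` K k), (delta k); split => //.
- by rewrite Kk/=; apply: le_lt_trans Koo; rewrite le_leb.
- by move=> x [Ax Kx]; split => //; rewrite UE; exists k.
- by move=> x y [_]; exact: Kd.
Qed.

End euclidean_norm.

(** * Integrals of nonnegative functions and Tonelli on rectangles *)

Section nonnegative_integrals.
Context disp (T : measurableType disp) (R : realType).
Variable m : {measure set T -> \bar R}.
Implicit Types (D : set T) (f g : T -> \bar R).
Local Open Scope ereal_scope.

(** The integral of a nonnegative function is a supremum over the simple
    functions below it, which is monotone whether or not it is measurable. *)
Lemma le_integral_ge0 D D' f g : D `<=` D' -> (forall x, D x -> 0 <= f x) ->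
  (forall x, D' x -> 0 <= g x) -> (forall x, D x -> f x <= g x) ->
  \int[m]_(x in D) f x <= \int[m]_(x in D') g x.
Proof.
move=> DD' f0 g0 fg; rewrite (integral_mkcond D f) (integral_mkcond D' g).
have fD0 x : 0 <= (f \_ D) x by apply: erestrict_ge0.
have gD0 x : 0 <= (g \_ D') x by apply: erestrict_ge0.
have fgD x : (f \_ D) x <= (g \_ D') x.
  rewrite !patchE; have [/set_mem Dx|_] := boolP (x \in D).
    by rewrite ifT ?inE; [exact: fg|exact: DD'].
  by case: ifPn => // /set_mem; exact: g0.
rewrite !ge0_integralTE//; apply: ereal_sup_le => _ [h hf <-].
by exists h => // x; exact: le_trans (fgD x).
Qed.

(** The larger function is made infinite on the exceptional null set. *)
Lemma ae_le_integral_ge0 D f g : measurable D ->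
  (forall x, D x -> 0 <= f x) -> (forall x, D x -> 0 <= g x) ->
  measurable_fun D g -> {ae m, forall x, D x -> f x <= g x} ->
  \int[m]_(x in D) f x <= \int[m]_(x in D) g x.
Proof.
move=> mD f0 g0 mg [N [mN N0 fgN]].
pose h x := if x \in N then +oo else g x.
have fh x : D x -> f x <= h x.
  move=> Dx; rewrite /h; case: ifPn => [_|]; first exact: leey.
  rewrite notin_setE => Nx; apply: contrapT => fg; apply: Nx; apply: fgN => /=.
  by move=> /(_ Dx).
have h0 x : D x -> 0 <= h x by move=> Dx; exact: le_trans (f0 _ Dx) (fh _ Dx).
apply: (le_trans (le_integral_ge0 (@subset_refl _ D) f0 h0 fh)).
rewrite le_eqVlt; apply/orP; left; apply/eqP.
apply: ge0_ae_eq_integral => //.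
- apply: measurable_fun_if => //.
  + apply: (measurable_fun_bool true); rewrite (_ : _ @^-1` _ = N).
      exact: measurableI.
    by apply/seteqP; split => x /=; [exact: set_mem|exact: mem_set].
  + by apply: measurable_funS mg => // x [].
exists N; split => // x /= nh; apply: contrapT => Nx; apply: nh => Dx.
by rewrite /h ifF//; apply/negbTE; rewrite notin_setE.
Qed.

End nonnegative_integrals.

Section tonelli_rectangle.
Context d1 d2 (T1 : measurableType d1) (T2 : measurableType d2) (R : realType).
Variables (m1 : {sigma_finite_measure set T1 -> \bar R}).
Variables (m2 : {sigma_finite_measure set T2 -> \bar R}).
Variables (A : set T1) (B : set T2) (f : T1 * T2 -> \bar R).
Hypotheses (mA : measurable A) (mB : measurable B).
Hypotheses (mf : measurable_fun setT f) (f0 : forall z, (0 <= f z)%E).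
Local Open Scope ereal_scope.

Let g := f \_ (A `*` B).

Let mg : measurable_fun setT g.
Proof.
apply: (measurable_restrictT _ (measurableX mA mB)).1; exact: measurable_funTS.
Qed.

Let g0 z : 0 <= g z.
Proof. by apply: erestrict_ge0 => ? _; exact: f0. Qed.

Let inner2 x : \int[m2]_y g (x, y) = ((fun x => \int[m2]_(y in B) f (x, y)) \_ A) x.
Proof.
rewrite patchE; case: ifPn => [/set_mem Ax|/negP xA].
  rewrite [RHS]integral_mkcond; apply: eq_integral => y _; rewrite /g !patchE.
  have [yB|yB] := boolP (y \in B).
    by rewrite ifT// inE; split => //; exact: set_mem.
  by rewrite ifF//; apply/negbTE; apply: contra yB; rewrite !inE => -[].
rewrite integral0_eq// => y _; rewrite /g patchE ifF//.
by apply/negP; rewrite inE => -[/= Ax _]; apply: xA; rewrite inE.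
Qed.

Let inner1 y : \int[m1]_x g (x, y) = ((fun y => \int[m1]_(x in A) f (x, y)) \_ B) y.
Proof.
rewrite patchE; case: ifPn => [/set_mem By|/negP yB].
  rewrite [RHS]integral_mkcond; apply: eq_integral => x _; rewrite /g !patchE.
  have [xA|xA] := boolP (x \in A).
    by rewrite ifT// inE; split => //; exact: set_mem.
  by rewrite ifF//; apply/negbTE; apply: contra xA; rewrite !inE => -[].
rewrite integral0_eq// => x _; rewrite /g patchE ifF//.
by apply/negP; rewrite inE => -[/= _ By]; apply: yB; rewrite inE.
Qed.

Lemma tonelli_rectangle1 : \int[m1 \x m2]_(z in A `*` B) f z =
  \int[m1]_(x in A) \int[m2]_(y in B) f (x, y).
Proof.
rewrite [LHS]integral_mkcond [RHS]integral_mkcond.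
rewrite (fubini_tonelli1 _ mg g0); apply: eq_integral => x _; exact: inner2.
Qed.

Lemma tonelli_rectangle2 : \int[m1 \x m2]_(z in A `*` B) f z =
  \int[m2]_(y in B) \int[m1]_(x in A) f (x, y).
Proof.
rewrite [LHS]integral_mkcond [RHS]integral_mkcond.
rewrite (fubini_tonelli2 _ mg g0); apply: eq_integral => y _; exact: inner1.
Qed.

Lemma measurable_tonelli1 : measurable_fun A (fun x => \int[m2]_(y in B) f (x, y)).
Proof.
apply/(measurable_restrictT _ mA).
rewrite -(funext inner2 : fubini_F m2 g = _).
exact: measurable_fun_fubini_tonelli_F.
Qed.

Lemma measurable_tonelli2 : measurable_fun B (fun y => \int[m1]_(x in A) f (x, y)).
Proof.
apply/(measurable_restrictT _ mB).
rewrite -(funext inner1 : fubini_G m1 g = _).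
exact: measurable_fun_fubini_tonelli_G.
Qed.

End tonelli_rectangle.

(** * Weighted integrals of p-th powers *)

Section weighted_powR_integral.
Context disp (T : measurableType disp) (R : realType).
Variables (m : {measure set T -> \bar R}) (D : set T) (p : R) (k : T -> R).
Hypotheses (p_gt1 : 1 < p) (mD : measurable D) (mk : measurable_fun setT k).
Hypothesis k0 : forall z, 0 <= k z.
Implicit Types (f g h : T -> R) (A B : R).

Definition powR_integral f := (\int[m]_(z in D) (`|f z| `^ p * k z)%:E)%E.

Lemma measurable_normr_powR f : measurable_fun setT f ->
  measurable_fun setT (fun z => `|f z| `^ p).
Proof.
move=> mf; apply: (measurableT_comp (measurable_powR p)).
exact: measurableT_comp.
Qed.

Lemma measurable_powR_weight f : measurable_fun setT f ->
  measurable_fun D (fun z => (`|f z| `^ p * k z)%:E).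
Proof.
move=> mf; apply: measurable_funTS; apply/measurable_EFinP/measurable_funM => //.
exact: measurable_normr_powR.
Qed.

Lemma powR_weight_ge0 f z : (0 <= (`|f z| `^ p * k z)%:E)%E.
Proof. by rewrite lee_fin mulr_ge0 ?powR_ge0. Qed.

Lemma powR_integral_ge0 f : (0 <= powR_integral f)%E.
Proof. by apply: integral_ge0 => z _; exact: powR_weight_ge0. Qed.

Lemma powR_integral_comb A B f g : 0 <= A -> 0 <= B ->
  measurable_fun setT f -> measurable_fun setT g ->
  (A%:E * powR_integral f + B%:E * powR_integral g =
   \int[m]_(z in D) ((A * `|f z| `^ p + B * `|g z| `^ p) * k z)%:E)%E.
Proof.
move=> A0 B0 mf mg.
rewrite -!ge0_integralZl_EFin//; first last.
- exact: measurable_powR_weight.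
- by move=> z _; exact: powR_weight_ge0.
- exact: measurable_powR_weight.
- by move=> z _; exact: powR_weight_ge0.
rewrite -ge0_integralD//; first last.
- exact/measurable_funeM/measurable_powR_weight.
- by move=> z _; rewrite mule_ge0// powR_weight_ge0.
- exact/measurable_funeM/measurable_powR_weight.
- by move=> z _; rewrite mule_ge0// powR_weight_ge0.
by apply: eq_integral => z _; rewrite -!EFinM -EFinD mulrDl !mulrA.
Qed.

(** The common form of the two inequalities used for the energy: a weak triangle
    inequality, for [A2 = 0], and uniform convexity. *)
Lemma powR_integral_le_comb (A2 A3 A4 : R) f g :
  0 <= A2 -> 0 <= A3 -> 0 <= A4 ->
  (forall a b : R, `|a - b| `^ p + A2 * `|(a + b) / 2| `^ p <=
    A3 * `|a| `^ p + A4 * `|b| `^ p) ->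
  measurable_fun setT f -> measurable_fun setT g ->
  (powR_integral (fun z => f z - g z)%R +
   A2%:E * powR_integral (fun z => (f z + g z) / 2)%R <=
   A3%:E * powR_integral f + A4%:E * powR_integral g)%E.
Proof.
move=> A20 A30 A40 H mf mg.
have md : measurable_fun setT (fun z => f z - g z) by exact: measurable_funB.
have ms : measurable_fun setT (fun z => (f z + g z) / 2).
  by apply: measurable_funM => //; exact: measurable_funD.
rewrite (powR_integral_comb A30 A40 mf mg).
have := powR_integral_comb ler01 A20 md ms; rewrite mul1e => ->.
have mc A B f1 f2 : measurable_fun setT f1 -> measurable_fun setT f2 ->
    measurable_fun D (fun z => ((A * `|f1 z| `^ p + B * `|f2 z| `^ p) * k z)%:E).
  move=> m1 m2; apply: measurable_funTS; apply/measurable_EFinP/measurable_funM => //.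
  by apply: measurable_funD; apply: measurable_funM => //; exact: measurable_normr_powR.
apply: ge0_le_integral => //.
- move=> z _; rewrite lee_fin mulr_ge0// mul1r.
  by rewrite addr_ge0 ?mulr_ge0 ?powR_ge0.
- exact: mc.
- exact: mc.
- by move=> z _; rewrite lee_fin ler_wpM2r// mul1r.
Qed.

(** Off the exceptional null set the limit inferior is the limit. *)
Lemma powR_integral_fatou (f_ : nat -> T -> R) f :
  (forall n, measurable_fun setT (f_ n)) -> measurable_fun setT f ->
  {ae m, forall z, D z -> f_ n z @[n --> \oo] --> f z} ->
  (powR_integral f <= limn_einf (fun n => powR_integral (f_ n)))%E.
Proof.
move=> mf_ mf [N [mN N0 cN]].
have removeN g : measurable_fun setT g ->
    powR_integral g = (\int[m]_(z in D `\` N) (`|g z| `^ p * k z)%:E)%E.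
  move=> mg; rewrite /powR_integral (ge0_negligible_integral mN)//.
    exact: measurable_powR_weight.
  by move=> z _; exact: powR_weight_ge0.
rewrite removeN//; under [X in limn_einf X]eq_fun => n do rewrite removeN//.
have mDN := measurableD mD mN.
rewrite (eq_integral (fun z => limn_einf (fun n => (`|f_ n z| `^ p * k z)%:E))).
  apply: fatou => // [n|n z _]; last exact: powR_weight_ge0.
  by apply: measurable_funS (measurable_powR_weight (mf_ n)) => // z [].
move=> z; rewrite inE => -[Dz Nz]; apply/esym.
have fz : f_ n z @[n --> \oo] --> f z.
  by apply: contrapT => nfz; apply: Nz; apply: cN => /(_ Dz).
suff /cvg_limn_einf_sup[-> _//] :
  (`|f_ n z| `^ p * k z)%:E @[n --> \oo] --> (`|f z| `^ p * k z)%:E by [].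
apply/fine_cvgP; split; first exact: nearW.
apply: cvgM; last exact: cvg_cst.
have cp : {for f z, continuous (fun t : R => `|t| `^ p)}.
  exact: continuous_normr_powR.
exact: (continuous_cvg _ cp fz).
Qed.

End weighted_powR_integral.

Section limn_einf_superadditive.
Variable R : realType.
Implicit Types a b : nat -> \bar R.
Local Open Scope ereal_scope.

Lemma limn_einf_le a M : (forall n, a n <= M) -> limn_einf a <= M.
Proof.
move=> aM; rewrite limn_einf_lim; apply: lime_le; first exact: is_cvg_einfs.
apply: nearW => n; apply: le_trans (aM n); apply: ereal_inf_lbound.
by exists n => /=.
Qed.

Lemma limn_einf_ge0 a : (forall n, 0 <= a n) -> 0 <= limn_einf a.
Proof.
move=> a0; rewrite limn_einf_lim; apply: lime_ge; first exact: is_cvg_einfs.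
by apply: nearW => n; apply: le_ereal_inf_tmp => _ [k _ <-].
Qed.

Lemma limn_einfD_le a b : (forall n, 0 <= a n) -> (forall n, 0 <= b n) ->
  limn_einf a + limn_einf b <= limn_einf (fun n => a n + b n).
Proof.
move=> a0 b0; rewrite !limn_einf_lim.
have e0 (u : nat -> \bar R) n : (forall n, 0 <= u n) -> 0 <= einfs u n.
  by move=> u0; apply: le_ereal_inf_tmp => _ [k _ <-].
have l0 (u : nat -> \bar R) : (forall n, 0 <= u n) -> 0 <= limn (einfs u).
  by move=> u0; have := limn_einf_ge0 u0; rewrite limn_einf_lim.
rewrite -limeD; [|exact: is_cvg_einfs|exact: is_cvg_einfs|]; last first.
  by apply: ge0_adde_def; rewrite inE l0.
apply: lee_lim.
- by apply: is_cvgeD; [|exact: is_cvg_einfs|exact: is_cvg_einfs];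
    apply: ge0_adde_def; rewrite inE l0.
- exact: is_cvg_einfs.
apply: nearW => n; apply: le_ereal_inf_tmp => _ [k nk <-].
by apply: leeD; apply: ereal_inf_lbound; exists k.
Qed.

End limn_einf_superadditive.

Section product_ae.
Variables (R : realType) (d : nat).
Notation X := (eucl R d).
Notation mu := (@leb R d).

Lemma ae_leb_reflect (P : X -> Prop) x :
  {ae mu, forall h, P h} -> {ae mu, forall y, P (x - y)}.
Proof.
move=> [N [mN N0 PN]]; exists ((fun y => x - y) @^-1` N); split.
- by rewrite -[X in measurable X]setTI; exact: measurable_reflect.
- by rewrite -[LHS]/(mu _) leb_reflect.
- by move=> y Py; exact: PN.
Qed.

Lemma ae_prod (P : X -> Prop) : {ae mu, forall x, P x} ->
  {ae (mu \x mu)%E, forall z, P z.1 /\ P z.2}.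
Proof.
move=> [N [mN N0 PN]]; exists ((N `*` setT) `|` (setT `*` N)).
have m1 : measurable (N `*` [set: X]) by exact: measurableX.
have m2 : measurable ([set: X] `*` N) by exact: measurableX.
split.
- exact: measurableU.
- apply/eqP; rewrite -measure_le0.
  have e1 : (mu \x mu)%E (N `*` [set: X]) = 0%E.
    apply: etrans (product_measure1E _ _ mN measurableT) _.
    exact: etrans (congr1 (fun t => t * _)%E N0) (mul0e _).
  have e2 : (mu \x mu)%E ([set: X] `*` N) = 0%E.
    apply: etrans (product_measure1E _ _ measurableT mN) _.
    exact: etrans (congr1 (fun t => _ * t)%E N0) (mule0 _).
  apply: (@le_trans _ _ ((mu \x mu)%E (N `*` [set: X]) +
                         (mu \x mu)%E ([set: X] `*` N))%E).
    exact: measureU2.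
  by rewrite e1 e2 adde0.
- move=> z /= /not_andP[nP|nP]; [left|right]; split => //; exact: PN.
Qed.

End product_ae.

(** * The energy: pointwise inequalities and lower semicontinuity *)

Section nonlocal_energy_as_product_integral.
Variables (R : realType) (d : nat).
Notation X := (eucl R d).
Notation mu := (@leb R d).
Variables (Omega : set X) (p : R) (nu : X -> R).
Hypotheses (p_gt1 : 1 < p) (mOmega : measurable Omega).
Hypothesis mnu : measurable_fun (~` [set (0 : X)]) nu.
Hypothesis nu_ge0 : forall h, h != 0 -> 0 <= nu h.
Implicit Types u : X -> R.

Lemma measurable_eucl1 (x : X) : measurable [set x].
Proof.
rewrite (_ : [set x] = box x x); first exact: measurable_box.
apply/seteqP; split => y /=; first by move=> -> i; rewrite lexx.
by move=> h; apply/rowP => i; apply/eqP; rewrite eq_sym eq_le; exact: h.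
Qed.

Let nu0 : X -> R := nu \_ (~` [set (0 : X)]).

Let mnu0 : measurable_fun setT nu0.
Proof.
have mC : measurable (~` [set (0 : X)]).
  by apply: measurableC; exact: measurable_eucl1.
exact: (measurable_restrictT _ mC).1 mnu.
Qed.

Let nu0E h : h != 0 -> nu0 h = nu h.
Proof.
by move=> h0; rewrite /nu0 patchE ifT// inE/=; exact/eqP.
Qed.

Let nu0_ge0 h : 0 <= nu0 h.
Proof.
by rewrite /nu0 patchE; case: ifPn => //; rewrite inE/= => /eqP; exact: nu_ge0.
Qed.

(** Extended by 0 at the origin, the kernel is nonnegative and measurable on the
    whole space. *)
Lemma kernel_borel_version : exists k : X -> R,
  [/\ measurable_fun setT (k : borel_eucl R d -> R), forall x, 0 <= k x &
      {ae mu, forall h, h != 0 -> nu h = k h}].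
Proof.
have [k [mk k0 nuk]] := borel_version mnu0 nu0_ge0.
exists k; split => //; apply: filterS nuk => h <- h0.
by rewrite nu0E.
Qed.

Variable k : X -> R.
Hypothesis mk : measurable_fun setT (k : borel_eucl R d -> R).
Hypothesis k_ge0 : forall x, 0 <= k x.
Hypothesis nuk : {ae mu, forall h, h != 0 -> nu h = k h}.

Lemma measurable_kernel_sub : measurable_fun setT (fun z : X * X => k (z.1 - z.2)).
Proof. exact: (measurableT_comp mk (@measurable_sub R d)). Qed.

Lemma measurable_kernel_section (x : X) : measurable_fun setT (fun y : X => k (x - y)).
Proof.
apply: (measurableT_comp mk); apply: measurable_into_borel => i.
exact: (measurableT_comp (measurable_coord i) (measurable_reflect x)).
Qed.

Lemma kernel_section_ae (x : X) : {ae mu, forall y, y != x -> nu (x - y) = k (x - y)}.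
Proof.
apply: filterS (ae_leb_reflect x nuk) => y h yx; apply: h.
by rewrite subr_eq0 eq_sym.
Qed.

Lemma nu_section_measurable (x : X) (f : X -> R) :
  measurable_fun setT f -> f x = 0 ->
  measurable_fun setT (fun y : X => f y * nu (x - y)).
Proof.
move=> mf fx; rewrite (_ : (fun _ => _) = (fun y => f y * nu0 (x - y))).
  apply: measurable_funM; first exact: mf.
  exact: (measurableT_comp mnu0 (measurable_reflect x)).
apply/funext => y; have [->|yx] := eqVneq y x; first by rewrite fx !mul0r.
by rewrite nu0E// subr_eq0 eq_sym.
Qed.

(** The integrands differ on a null set only, for each [x]; the diagonal
    contributes nothing as the difference of [u] vanishes there. *)
Lemma nonlocal_energy_kernel u : measurable_fun setT u ->
  nonlocal_energy p nu Omega u =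
  (\int[mu]_(x in Omega) \int[mu]_y (`|u x - u y| `^ p * k (x - y)%R)%:E)%E.
Proof.
move=> mu_u; apply: eq_integral => x _.
have mux : measurable_fun setT (fun y => u x - u y).
  exact: measurable_funB (measurable_cst _) mu_u.
have p0 : p != 0 by rewrite gt_eqF// (lt_trans _ p_gt1).
apply: (ge0_ae_eq_integral measurableT).
- apply/measurable_EFinP; apply: nu_section_measurable.
    exact: measurable_normr_powR mux.
  by rewrite subrr normr0 powR0.
- apply/measurable_EFinP; apply: measurable_funM (measurable_kernel_section x).
  exact: measurable_normr_powR mux.
- move=> y _; rewrite lee_fin; have [->|yx] := eqVneq y x.
    by rewrite subrr normr0 powR0 ?mul0r.
  by rewrite mulr_ge0 ?powR_ge0// nu_ge0// subr_eq0 eq_sym.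
- by move=> y _; rewrite lee_fin mulr_ge0 ?powR_ge0.
apply: filterS (kernel_section_ae x) => y h _.
have [->|yx] := eqVneq y x; last by rewrite h.
by rewrite subrr normr0 powR0 ?mul0r.
Qed.

Lemma nonlocal_energyE u : measurable_fun setT u ->
  nonlocal_energy p nu Omega u =
  powR_integral (mu \x mu)%E (Omega `*` setT) p
    (fun z => k (z.1 - z.2)) (fun z => u z.1 - u z.2).
Proof.
move=> mu_u; rewrite nonlocal_energy_kernel// /powR_integral.
set F : X * X -> \bar R := fun z => _.
have mD : measurable_fun setT (fun z : X * X => u z.1 - u z.2).
  by apply: measurable_funB; exact: measurableT_comp.
have mF : measurable_fun setT F.
  apply/measurable_EFinP/measurable_funM; last exact: measurable_kernel_sub.
  exact: measurable_normr_powR.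
have F0 z : (0 <= F z)%E by rewrite lee_fin mulr_ge0 ?powR_ge0.
exact/esym/tonelli_rectangle1.
Qed.

End nonlocal_energy_as_product_integral.

Section energy.
Variables (R : realType) (d : nat).
Notation X := (eucl R d).
Notation mu := (@leb R d).
Variables (Omega : set X) (p : R) (nu : X -> R).
Hypotheses (p_gt1 : 1 < p) (mOmega : measurable Omega).
Hypothesis nu_levy : levy_kernel p nu.
Implicit Types (u v w : X -> R) (M : \bar R).

(** The p-th power of [W_norm], locked so that unification does not unfold it
    when it is compared with other extended reals. *)
Definition energy : (X -> R) -> \bar R :=
  locked (fun u => (Lp_energy p Omega u + nonlocal_energy p nu Omega u)%E).

Lemma energyE u :
  energy u = (Lp_energy p Omega u + nonlocal_energy p nu Omega u)%E.
Proof. by rewrite /energy -lock. Qed.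

Let Lp_energyE u : Lp_energy p Omega u = powR_integral mu Omega p (cst 1) u.
Proof. by apply: eq_integral => x _; rewrite mulr1. Qed.

Let kernelP : exists k : X -> R,
  [/\ measurable_fun setT (fun z : X * X => k (z.1 - z.2)), forall x, 0 <= k x &
      forall u, measurable_fun setT u -> nonlocal_energy p nu Omega u =
        powR_integral (mu \x mu)%E (Omega `*` setT) p
          (fun z => k (z.1 - z.2)) (fun z => u z.1 - u z.2)].
Proof.
have [mnu nu0 _ _] := nu_levy.
have [k [mk k0 nuk]] := kernel_borel_version mnu nu0.
exists k; split => //; first exact: measurable_kernel_sub.
by move=> u mu_u; exact: nonlocal_energyE.
Qed.

Let mdiff u : measurable_fun setT u ->
  measurable_fun setT (fun z : X * X => u z.1 - u z.2).
Proof. by move=> mu_u; apply: measurable_funB; exact: measurableT_comp. Qed.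

Let mOT : measurable (Omega `*` [set: X]).
Proof. exact: measurableX. Qed.

Lemma Lp_energy_ge0 u : (0 <= Lp_energy p Omega u)%E.
Proof. by apply: integral_ge0 => x _; rewrite lee_fin powR_ge0. Qed.

Lemma nonlocal_energy_ge0 u : (0 <= nonlocal_energy p nu Omega u)%E.
Proof.
have [_ nu0 _ _] := nu_levy.
apply: integral_ge0 => x _; apply: integral_ge0 => y _; rewrite lee_fin.
have [->|yx] := eqVneq y x.
  by rewrite subrr normr0 powR0 ?mul0r// gt_eqF// (lt_trans _ p_gt1).
by rewrite mulr_ge0 ?powR_ge0// nu0// subr_eq0 eq_sym.
Qed.

Lemma energy_ge0 u : (0 <= energy u)%E.
Proof. by rewrite energyE adde_ge0 ?Lp_energy_ge0 ?nonlocal_energy_ge0. Qed.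

Lemma W_spaceE u :
  W_space p nu Omega u <-> measurable_fun setT u /\ (energy u < +oo)%E.
Proof.
rewrite energyE; split => [[mu_u Lu Nu]|[mu_u E]].
  by split => //; exact: lte_add_pinfty.
split => //; apply: le_lt_trans E.
  by rewrite leeDl// nonlocal_energy_ge0.
by rewrite leeDr// Lp_energy_ge0.
Qed.

(** The inequality holds for both terms of the energy, as the nonlocal one is a
    weighted integral of powers of differences, which are linear in [u]. *)
Lemma energy_le_comb (A2 A3 A4 : R) u w :
  0 <= A2 -> 0 <= A3 -> 0 <= A4 ->
  (forall a b : R, `|a - b| `^ p + A2 * `|(a + b) / 2| `^ p <=
    A3 * `|a| `^ p + A4 * `|b| `^ p) ->
  measurable_fun setT u -> measurable_fun setT w ->
  (energy (fun x => u x - w x)%R + A2%:E * energy (fun x => (u x + w x) / 2)%R <=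
   A3%:E * energy u + A4%:E * energy w)%E.
Proof.
move=> A20 A30 A40 H mu_u mw; rewrite !energyE.
have [k [mk k0 kE]] := kernelP.
have md : measurable_fun setT (fun x => u x - w x) by exact: measurable_funB.
have ms : measurable_fun setT (fun x => (u x + w x) / 2).
  exact: measurable_funM (measurable_funD mu_u mw) (measurable_cst _).
have P0 f := powR_integral_ge0 mu Omega p (fun=> ler01) f.
have Q0 f := powR_integral_ge0 (mu \x mu)%E (Omega `*` setT) p
  (fun z => k0 (z.1 - z.2)) f.
rewrite !Lp_energyE (kE _ md) (kE _ ms) (kE _ mu_u) (kE _ mw).
rewrite !(ge0_muleDr _ (P0 _) (Q0 _)) addeACA [leRHS]addeACA; apply: leeD.
  exact: (powR_integral_le_comb mu mOmega (measurable_cst (1 : R)) (fun=> ler01)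
    A20 A30 A40 H mu_u mw).
have -> : (fun z : X * X => (u z.1 - w z.1) - (u z.2 - w z.2)) =
    (fun z => (u z.1 - u z.2) - (w z.1 - w z.2)).
  by apply/funext => z; ring.
have -> : (fun z : X * X => (u z.1 + w z.1) / 2 - (u z.2 + w z.2) / 2) =
    (fun z => ((u z.1 - u z.2) + (w z.1 - w z.2)) / 2).
  by apply/funext => z; ring.
exact: (powR_integral_le_comb (mu \x mu)%E mOT mk (fun z => k0 _) A20 A30 A40 H
  (mdiff mu_u) (mdiff mw)).
Qed.

Lemma energy_fatou (u_ : nat -> X -> R) u M :
  (forall n, measurable_fun setT (u_ n)) -> measurable_fun setT u ->
  {ae mu, forall x, u_ n x @[n --> \oo] --> u x} ->
  (forall n, energy (u_ n) <= M)%E -> (energy u <= M)%E.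
Proof.
move=> mu_ mu_u cu EM; have [k [mk k0 kE]] := kernelP.
apply: (le_trans _ (limn_einf_le EM)).
rewrite energyE; under [X in limn_einf X]eq_fun do rewrite energyE.
apply: le_trans (limn_einfD_le (fun n => Lp_energy_ge0 _)
                               (fun n => nonlocal_energy_ge0 _)).
apply: leeD.
  rewrite Lp_energyE; under [X in limn_einf X]eq_fun do rewrite Lp_energyE.
  apply: powR_integral_fatou => //.
  by apply: filterS cu => x + _.
rewrite kE//; under [X in limn_einf X]eq_fun do rewrite kE//.
apply: powR_integral_fatou => //; [by move=> n; exact: mdiff|exact: mdiff|].
by apply: filterS (ae_prod cu) => z [c1 c2] _; exact: cvgB.
Qed.

End energy.

(** * Almost everywhere convergence of fast Cauchy sequences *)

Section fast_cauchy.
Variables (R : realType) (d : nat).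
Notation X := (eucl R d).
Notation mu := (@leb R d).
Variables (Omega : set X) (p : R).
Hypotheses (p_gt1 : 1 < p) (mOmega : measurable Omega).
Implicit Types u : X -> R.

Let p_gt0 : 0 < p. Proof. exact: lt_trans p_gt1. Qed.

Lemma Lp_energyZ (c : R) u : 0 <= c -> measurable_fun setT u ->
  Lp_energy p Omega (fun x => c * u x) = ((c `^ p)%:E * Lp_energy p Omega u)%E.
Proof.
move=> c0 mu_u; rewrite /Lp_energy.
have mf : measurable_fun Omega (fun x => (`|u x| `^ p)%:E).
  by apply: measurable_funTS; apply/measurable_EFinP; exact: measurable_normr_powR.
have f0 x : Omega x -> (0 <= (`|u x| `^ p)%:E)%E by rewrite lee_fin powR_ge0.
rewrite -(ge0_integralZl_EFin mu mOmega f0 mf (powR_ge0 c p)).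
by apply: eq_integral => x _; rewrite -EFinM normrM powRM// ger0_norm.
Qed.

(** The series of the p-th powers of the increments scaled by [2 ^+ k] has a
    finite integral; where its sum is finite the increments are dominated by a
    geometric sequence. *)
Lemma Lp_fast_cauchy_cvg (u_ : nat -> X -> R) :
  (forall n, measurable_fun setT (u_ n)) ->
  (forall k, (Lp_energy p Omega (fun x => u_ k.+1 x - u_ k x)%R <=
    (1 / (2 ^ k.+1)%:R / ((2 ^ k)%:R `^ p))%:E)%E) ->
  {ae mu, forall x, Omega x -> cvg (u_ n x @[n --> \oo])}.
Proof.
move=> mu_ small; pose D k x := u_ k.+1 x - u_ k x.
have mD k : measurable_fun setT (D k) by exact: measurable_funB.
pose f k (x : X) : \bar R := (`|(2 ^ k)%:R * D k x| `^ p)%:E.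
have f0 k x : (0 <= f k x)%E by rewrite lee_fin powR_ge0.
have mf k : measurable_fun Omega (f k).
  apply: measurable_funTS; apply/measurable_EFinP; apply: measurable_normr_powR.
  exact: measurable_funM (measurable_cst _) (mD k).
have mg : measurable_fun Omega (fun x => \sum_(k <oo) f k x)%E.
  by apply: ge0_emeasurable_sum; [move=> k x _ _; exact: f0|move=> k _; exact: mf].
have g0 x : (0 <= \sum_(k <oo) f k x)%E by apply: nneseries_ge0.
have int_g : mu.-integrable Omega (fun x => \sum_(k <oo) f k x)%E.
  apply/integrableP; split => //.
  under eq_integral do rewrite gee0_abs//.
  rewrite integral_nneseries//.
  apply: (@le_lt_trans _ _ (\sum_(k <oo) (1 / (2 ^ (k + 1))%:R)%:E)%E); last first.
    by rewrite (cvg_lim _ (@cvg_geometric_eseries_half _ 1 0))// ltry.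
  apply: lee_nneseries => k _; first by move=> _; apply: integral_ge0 => x _; exact: f0.
  have := Lp_energyZ (ler0n R (2 ^ k)) (mD k); rewrite /Lp_energy -/(f k) => ->.
  apply: le_trans (lee_wpmul2l _ (small k)) _; first by rewrite lee_fin powR_ge0.
  by rewrite -EFinM lee_fin mulrC divfK ?addn1// gt_eqF// powR_gt0// ltr0n expn_gt0.
apply: filterS (integrable_ae mOmega int_g) => x + Ox => /(_ Ox) gfin.
pose G := fine (\sum_(k <oo) f k x)%E.
have DG k : `|D k x| <= G `^ p^-1 * 2^-1 ^+ k.
  have : (f k x <= G%:E)%E.
    rewrite fineK//; apply: le_trans (nneseries_lim_ge k.+1 (fun n _ _ => f0 n x)).
    by rewrite big_nat_recr//= leeDr// sume_ge0.
  rewrite lee_fin => fG.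
  have : (`|(2 ^ k)%:R * D k x| `^ p) `^ p^-1 <= G `^ p^-1.
    by apply: ge0_ler_powR; rewrite ?nnegrE ?powR_ge0 ?invr_ge0 ?(ltW p_gt0)// fine_ge0.
  rewrite -powRrM mulfV ?gt_eqF// powRr1// normrM ger0_norm// exprVn -natrX.
  by rewrite ler_pdivlMr ?ltr0n ?expn_gt0// mulrC.
have cD : cvgn (series (fun k => D k x)).
  apply: normed_cvg; apply: series_le_cvg DG _ => [n||].
  - exact: normr_ge0.
  - by move=> n; rewrite mulr_ge0 ?powR_ge0.
  - apply: (@is_cvg_geometric_series _ (G `^ p^-1) 2^-1).
    by rewrite ger0_norm ?invr_ge0// invf_lt1// ltr1n.
rewrite (_ : (fun n => u_ n x) = (fun n => u_ 0%N x + series (fun k => D k x) n)).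
  by apply: is_cvgD => //; exact: is_cvg_cst.
apply/funext => n; exact: (eq_sum_telescope (fun n => u_ n x)).
Qed.

End fast_cauchy.

(** * Uniform convexity and minimal extensions *)

Section minimal_extension.
Variables (R : realType) (d : nat).
Notation X := (eucl R d).
Notation mu := (@leb R d).
Variables (Omega : set X) (p : R) (nu : X -> R).
Hypotheses (p_gt1 : 1 < p) (mOmega : measurable Omega).
Hypothesis nu_levy : levy_kernel p nu.
Implicit Types (u v w : X -> R).

Notation W := (W_space p nu Omega).

Let p_gt0 : 0 < p. Proof. exact: lt_trans p_gt1. Qed.

Definition fine_energy u : R := fine (energy Omega p nu u).
Notation E := fine_energy.

Let W_measurable u : W u -> measurable_fun setT u.
Proof. by case. Qed.

Lemma fine_energyE u : W u -> energy Omega p nu u = (E u)%:E.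
Proof.
move=> /(W_spaceE _ p_gt1 nu_levy)[_ fin]; rewrite fineK// ge0_fin_numE//.
exact: energy_ge0.
Qed.

Lemma fine_energy_ge0 u : 0 <= E u.
Proof. by rewrite fine_ge0// energy_ge0. Qed.

Lemma W_space_le u (M : R) : measurable_fun setT u ->
  (energy Omega p nu u <= M%:E)%E -> W u /\ E u <= M.
Proof.
move=> mu_u EM; have Wu : W u.
  apply/(W_spaceE _ p_gt1 nu_levy); split; first exact: mu_u.
  exact: le_lt_trans EM (ltry _).
by split; [exact: Wu|move: EM; rewrite (fine_energyE Wu) lee_fin].
Qed.

Lemma energyN u : energy Omega p nu (fun x => - u x) = energy Omega p nu u.
Proof.
have LN : Lp_energy p Omega (fun x => - u x) = Lp_energy p Omega u.
  by apply: eq_integral => x _; rewrite normrN.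
have NN : nonlocal_energy p nu Omega (fun x => - u x) = nonlocal_energy p nu Omega u.
  by apply: eq_integral => x _; apply: eq_integral => y _; rewrite -opprD normrN.
by rewrite !energyE LN NN.
Qed.

Lemma W_spaceN u : W u -> W (fun x => - u x) /\ E (fun x => - u x) = E u.
Proof.
move=> Wu; split; last by rewrite /fine_energy energyN.
have /(W_spaceE _ p_gt1 nu_levy)[mu_u fin] := Wu.
apply/(W_spaceE _ p_gt1 nu_levy); rewrite energyN; split; last exact: fin.
exact: measurable_funN.
Qed.

Lemma W_spaceB_le (e : R) : 0 < e -> exists2 C, 0 <= C & forall u w, W u -> W w ->
  W (fun x => u x - w x) /\ E (fun x => u x - w x) <= (1 + e) * E u + C * E w.
Proof.
move=> e0; have [C C0 HC] := powR_normD_le p_gt1 e0.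
exists C => [|u w Wu Ww]; first exact: C0.
have [mu_u mw] := (W_measurable Wu, W_measurable Ww).
apply: W_space_le; first exact: measurable_funB.
have -> : (((1 + e) * E u + C * E w)%:E = (1 + e)%:E * energy Omega p nu u +
    C%:E * energy Omega p nu w)%E.
  by rewrite (fine_energyE Wu) (fine_energyE Ww).
have e1 : 0 <= 1 + e by rewrite addr_ge0// ltW.
have := energy_le_comb p_gt1 mOmega nu_levy (lexx 0) e1 C0 _ mu_u mw.
rewrite mul0e adde0; apply => a b; rewrite mul0r addr0 -(normrN b).
exact: HC.
Qed.

Lemma W_spaceD_le (e : R) : 0 < e -> exists2 C, 0 <= C & forall u w, W u -> W w ->
  W (fun x => u x + w x) /\ E (fun x => u x + w x) <= (1 + e) * E u + C * E w.
Proof.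
move=> e0; have [C C0 HC] := W_spaceB_le e0; exists C => [|u w Wu Ww]; first exact: C0.
have [WNw ENw] := W_spaceN Ww; have := HC u _ Wu WNw; rewrite ENw.
by under eq_fun do rewrite opprK.
Qed.

Lemma W_spaceB u w : W u -> W w -> W (fun x => u x - w x).
Proof. by have [C _ HC] := W_spaceB_le ltr01; move=> Wu Ww; case: (HC _ _ Wu Ww). Qed.

(** With [m] the least energy in a fiber, this bounds the energy of [u - w] by
    [e * (E u + E w)] and [C] times the excess of the mean energy over [m]. *)
Lemma energy_uniformly_convex (e : R) : 0 < e -> exists2 C, 0 <= C &
  forall u w, W u -> W w -> W (fun x => (u x + w x) / 2) /\
    E (fun x => u x - w x) + C * E (fun x => (u x + w x) / 2) <=
    (e + C / 2) * (E u + E w).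
Proof.
move=> e0; have [C C0 HC] := powR_uniformly_convex p_gt1 e0.
have K0 : 0 <= e + C / 2 by rewrite addr_ge0 ?(ltW e0)// divr_ge0// ltW.
exists C => [|u w Wu Ww]; first exact: ltW.
have [mu_u mw] := (W_measurable Wu, W_measurable Ww).
have ms : measurable_fun setT (fun x => (u x + w x) / 2).
  exact: measurable_funM (measurable_funD mu_u mw) (measurable_cst _).
have pw (a b : R) : `|a - b| `^ p + C * `|(a + b) / 2| `^ p <=
    (e + C / 2) * `|a| `^ p + (e + C / 2) * `|b| `^ p.
  by have := HC a b; lra.
have := energy_le_comb p_gt1 mOmega nu_levy (ltW C0) K0 K0 pw mu_u mw.
rewrite (fine_energyE (W_spaceB Wu Ww)) (fine_energyE Wu) (fine_energyE Ww).
rewrite -!EFinM -EFinD => le_sum.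
have Wmid : W (fun x => (u x + w x) / 2).
  apply/(W_spaceE _ p_gt1 nu_levy); split; first exact: ms.
  rewrite ltNge leye_eq.
  apply/negP => /eqP fin; move: le_sum.
  by rewrite fin mulry gtr0_sg// mul1e addey.
split; first exact: Wmid.
move: le_sum; rewrite (fine_energyE Wmid) -EFinM -EFinD lee_fin.
by rewrite mulrDr.
Qed.

(** The fiber over [v] of the trace map. *)
Definition fiber v : set (X -> R) := [set u | W u /\ ae_eq mu (~` Omega) v u].

Lemma fiber_mid v u w : fiber v u -> fiber v w -> fiber v (fun x => (u x + w x) / 2).
Proof.
move=> [Wu vu] [Ww vw]; split.
  by have [C _ HC] := energy_uniformly_convex ltr01; case: (HC _ _ Wu Ww).
by apply: filterS2 vu vw => x h1 h2 Ox; rewrite -h1// -h2//; lra.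
Qed.

(** Two near-minimizers of the energy have a midpoint that does no better than
    the minimum, so uniform convexity makes their difference small. *)
Lemma near_minimizers_close v (m eta : R) : (forall w, fiber v w -> m <= E w) ->
  0 <= m -> 0 < eta -> exists s, [/\ 0 < s, s <= eta & forall u w,
    fiber v u -> fiber v w -> E u <= m + s -> E w <= m + s ->
    E (fun x => u x - w x) <= eta].
Proof.
move=> min_m m0 eta0.
(* Near-minimal energies are below [m + 1], so the first term of the convexity
   inequality is at most [eta / 2]; [s] then makes the second one as small. *)
have e0 : 0 < eta / (4 * (m + 1)) by rewrite divr_gt0// mulr_gt0// ltr_wpDl.
have [C C0 HC] := energy_uniformly_convex e0; set e := eta / _ in e0 HC.
pose s := Num.min (Num.min 1 eta) (eta / (2 * (C + 1))).
have C1 : 0 < C + 1 by rewrite ltr_wpDl.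
have s0 : 0 < s by rewrite !lt_min ltr01 eta0 divr_gt0// mulr_gt0.
have [s1 seta] : s <= 1 /\ s <= eta.
  by split; rewrite !ge_min lexx ?orbT.
exists s; split => // u w Fu Fw um wm.
have [_] := HC u w Fu.1 Fw.1; have := min_m _ (fiber_mid Fu Fw).
move: (E (fun x => (u x + w x) / 2)) => Em mEm le_sum.
have CmEm : C * m <= C * Em by rewrite ler_wpM2l.
have le1 : (e + C / 2) * (E u + E w) <= (e + C / 2) * (2 * (m + s)).
  by rewrite ler_wpM2l ?addr_ge0 ?divr_ge0 ?(ltW e0)//; lra.
have es : e * (2 * (m + s)) <= eta / 2.
  apply: (@le_trans _ _ (e * (2 * (m + 1)))); first by rewrite ler_wpM2l ?(ltW e0)//; lra.
  rewrite /e le_eqVlt; apply/orP; left; apply/eqP; field.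
  by rewrite gt_eqF// ltr_wpDl.
have Cs : C * s <= eta / 2.
  apply: (@le_trans _ _ (C * (eta / (2 * (C + 1))))).
    by rewrite ler_wpM2l// ge_min lexx orbT.
  rewrite mulrA ler_pdivrMr ?mulr_gt0//.
  have -> : eta / 2 * (2 * (C + 1)) = C * eta + eta by field.
  by rewrite lerDl ltW.
have : (e + C / 2) * (2 * (m + s)) = e * (2 * (m + s)) + C * m + C * s by field.
lra.
Qed.

(** A minimizing sequence, chosen so that consecutive terms are very close,
    converges almost everywhere; its terms agree outside [Omega]. *)
Lemma minimizer_exists v : fiber v !=set0 ->
  exists2 u, fiber v u & forall w, fiber v w -> E u <= E w.
Proof.
move=> [w0 Fw0]; pose S := [set E w | w in fiber v]; pose m := inf S.
have infS : has_inf S.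
  split; first by exists (E w0); exists w0.
  by exists 0 => _ [w _ <-]; exact: fine_energy_ge0.
have min_m w : fiber v w -> m <= E w by move=> Fw; apply: (ge_inf infS.2); exists w.
have m0 : 0 <= m.
  by apply: (lb_le_inf infS.1) => _ [w _ <-]; exact: fine_energy_ge0.
(* The rate of decay required for convergence almost everywhere. *)
pose eta k : R := 1 / (2 ^ k.+1)%:R / ((2 ^ k)%:R `^ p).
have eta0 k : 0 < eta k.
  by rewrite !divr_gt0 ?powR_gt0 ?ltr0n ?expn_gt0.
have [s sP] := choice (fun k => near_minimizers_close min_m m0 (eta0 k)).
(* Both [u_ k] and [u_ k.+1] must be within [s k] of the infimum. *)
have /choice[u_ uP] : forall k, exists u, fiber v u /\
    E u <= m + s k /\ E u <= m + s k.-1.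
  move=> k; have s0 : 0 < Num.min (s k) (s k.-1).
    by rewrite lt_min; have [-> _ _] := sP k; have [-> _ _] := sP k.-1.
  have [_ [u Fu <-] um] := inf_adherent s0 infS.
  exists u; split => //; split; apply: (le_trans (ltW um));
    by rewrite lerD2l ge_min lexx ?orbT.
have mu_ n : measurable_fun setT (u_ n) by have [[/W_measurable]] := uP n.
have Wu n : W (u_ n) by have [[]] := uP n.
have close k : E (fun x => u_ k.+1 x - u_ k x) <= eta k.
  have [Fk [Ek _]] := uP k; have [Fk1 [_ Ek1]] := uP k.+1.
  by have [_ _] := sP k; exact.
have cvgO : {ae mu, forall x, Omega x -> cvg (u_ n x @[n --> \oo])}.
  apply: (Lp_fast_cauchy_cvg p_gt1 mOmega mu_) => k.
  apply: (@le_trans _ _ (energy Omega p nu (fun x => u_ k.+1 x - u_ k x))).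
    by rewrite energyE leeDl// (nonlocal_energy_ge0 _ p_gt1 nu_levy).
  by rewrite (fine_energyE (W_spaceB (Wu _) (Wu _))) lee_fin.
have eqOc : {ae mu, forall x, forall n, (~` Omega) x -> v x = u_ n x}.
  by apply: ae_foralln => n; have [[]] := uP n.
(* The upper limit is a measurable choice of limit, also where there is none. *)
pose u x := fine (limn_esup (fun n => (u_ n x)%:E)).
have mu_u : measurable_fun setT u.
  apply: (measurableT_comp (fine_measurable measurableT)).
  by apply: measurable_fun_limn_esup => n; exact/measurable_EFinP.
have uE x l : u_ n x @[n --> \oo] --> l -> u x = l.
  move=> ul; suff /cvg_limn_einf_sup[_] : (u_ n x)%:E @[n --> \oo] --> l%:E.
    by rewrite /u => ->.
  by apply/fine_cvgP; split => //; exact: nearW.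
have vu : ae_eq mu (~` Omega) v u.
  apply: filterS eqOc => x vx Ox; apply/esym/uE.
  by under eq_fun do rewrite -vx//; exact: cvg_cst.
have cu : {ae mu, forall x, u_ n x @[n --> \oo] --> u x}.
  apply: filterS2 cvgO eqOc => x c1 c2; have [Ox|Ox] := pselect (Omega x).
    by have := c1 Ox => /cvg_ex[l ul]; rewrite (uE _ _ ul).
  have ul : u_ n x @[n --> \oo] --> v x.
    by under eq_fun do rewrite -c2//; exact: cvg_cst.
  by rewrite (uE _ _ ul).
(* Fatou's lemma for the tails, whose energies are below [m + t]. *)
have um t : 0 < t -> (energy Omega p nu u <= (m + t)%:E)%E.
  move=> t0; have [N Nt] : exists N : nat, N.+1%:R^-1 < t.
    by exists (Num.truncn t^-1); rewrite invf_plt ?posrE//; exact: truncnS_gt.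
  apply: (energy_fatou p_gt1 mOmega nu_levy (u_ := fun n => u_ (n + N)%N)) => //.
    by apply: filterS cu => x; rewrite -(cvg_shiftn N).
  move=> n; rewrite fine_energyE// lee_fin.
  have [_ [En _]] := uP (n + N)%N; apply: (le_trans En); rewrite lerD2l.
  have [_ seta _] := sP (n + N)%N; apply: (le_trans seta); apply: le_trans (ltW Nt).
  have t1 : 1 <= (2 ^ (n + N))%:R `^ p :> R.
    apply: (@le_trans _ _ (1 `^ p)); first by rewrite powR1.
    apply: ge0_ler_powR; rewrite ?nnegrE ?(ltW p_gt0)//.
    by rewrite ler1n expn_gt0.
  rewrite /eta ler_pdivrMr ?(lt_le_trans ltr01)// div1r.
  apply: (@le_trans _ _ N.+1%:R^-1); last by rewrite ler_peMr// invr_ge0.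
  rewrite lef_pV2 ?posrE ?ltr0n ?expn_gt0// ler_nat.
  by rewrite (@leq_trans (2 ^ N.+1))// ?leq_pexp2l// ?ltnS ?leq_addl// ltnW// ltn_expl.
have [Wuu _] := W_space_le mu_u (um 1 ltr01).
exists u => // w Fw; apply: le_trans (min_m _ Fw).
by apply/ler_addgt0Pr => t t0; rewrite -lee_fin -fine_energyE// um.
Qed.

End minimal_extension.

(** * The extension operator *)

Section extension_operator.
Variables (R : realType) (d : nat).
Notation X := (eucl R d).
Notation mu := (@leb R d).
Variables (Omega : set X) (p : R) (nu : X -> R).
Hypotheses (p_gt1 : 1 < p) (mOmega : measurable Omega).
Hypothesis nu_levy : levy_kernel p nu.
Implicit Types (u v w : X -> R).

Notation W := (W_space p nu Omega).
Notation T := (T_space p nu Omega).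
Notation Wnorm := (W_norm p nu Omega).
Notation Tnorm := (T_norm p nu Omega).
Notation E := (fine_energy Omega p nu).
Notation fiber := (fiber Omega p nu).

Let p_gt0 : 0 < p. Proof. exact: lt_trans p_gt1. Qed.

Lemma W_normE u : W u -> Wnorm u = ((E u) `^ p^-1)%:E.
Proof.
by move=> Wu; rewrite /W_norm -energyE (fine_energyE p_gt1 nu_levy Wu) poweR_EFin.
Qed.

Lemma ltr_powRV (a b : R) : 0 <= a -> 0 <= b -> (a `^ p^-1 < b) = (a < b `^ p).
Proof.
move=> a0 b0; apply/idP/idP => ab.
  have -> : a = (a `^ p^-1) `^ p by rewrite -powRrM mulVf ?gt_eqF// powRr1.
  by apply: gt0_ltr_powR; rewrite ?nnegrE ?powR_ge0.
have -> : b = (b `^ p) `^ p^-1 by rewrite -powRrM mulfV ?gt_eqF// powRr1.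
by apply: gt0_ltr_powR; rewrite ?invr_gt0 ?nnegrE ?powR_ge0.
Qed.

Lemma W_norm_lt u (t : R) : W u -> 0 <= t -> (Wnorm u < t%:E)%E = (E u < t `^ p).
Proof. by move=> Wu t0; rewrite W_normE// lte_fin ltr_powRV// fine_energy_ge0. Qed.

Lemma W_norm_le u w : W u -> W w -> E u <= E w -> (Wnorm u <= Wnorm w)%E.
Proof.
move=> Wu Ww uw; rewrite !W_normE// lee_fin.
by apply: ge0_ler_powR; rewrite ?invr_ge0 ?nnegrE ?(ltW p_gt0) ?fine_energy_ge0.
Qed.

Lemma T_norm_lt v (t : R) : 0 <= t -> (Tnorm v < t%:E)%E ->
  exists2 w, fiber v w & E w < t `^ p.
Proof.
move=> t0 /ereal_inf_lt[_ [w Fw <-]] wt; exists w; first exact: Fw.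
by rewrite -(W_norm_lt Fw.1 t0).
Qed.

Definition min_ext v : X -> R :=
  xget (cst 0) [set u | fiber v u /\ forall w, fiber v w -> E u <= E w].

Lemma min_extP v : T v ->
  fiber v (min_ext v) /\ forall w, fiber v w -> E (min_ext v) <= E w.
Proof.
move=> [_ [u0 Wu0 vu0]].
have [|u Fu umin] := @minimizer_exists _ _ Omega p nu p_gt1 mOmega nu_levy v.
  by exists u0.
exact: (@xgetPex _ (cst 0) [set u | fiber v u /\ forall w, fiber v w -> E u <= E w]
  (ex_intro _ u (conj Fu umin))).
Qed.

Lemma min_ext_bounded : seminorm_bounded T Tnorm Wnorm min_ext.
Proof.
exists 1 => v Tv; have [[We ve] emin] := min_extP Tv.
rewrite mul1e; apply: le_ereal_inf_tmp => _ [w Fw <-].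
exact: (W_norm_le We Fw.1 (emin _ Fw)).
Qed.

Let mul_divS_le (K t : R) : 0 <= K -> 0 <= t -> K * (t / (K + 1)) <= t.
Proof.
move=> K0 t0; rewrite mulrA ler_pdivrMr ?ltr_wpDl// mulrC.
by rewrite ler_wpM2l// lerDl.
Qed.

(** If [w] is a small extension of [v' - v], then [min_ext v' - w] extends [v]
    with almost minimal energy, hence is close to [min_ext v]. *)
Lemma min_ext_continuous : seminorm_continuous T W Tnorm Wnorm min_ext.
Proof.
split=> [v Tv|v Tv eps eps0]; first exact: (min_extP Tv).1.1.
have [Fu umin] := min_extP Tv; set u := min_ext v in Fu umin *.
set m := E u; have m0 : 0 <= m by exact: fine_energy_ge0.
set e := eps `^ p; have e0 : 0 < e by exact: powR_gt0.
have e8 : 0 < e / 8 by rewrite divr_gt0.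
have [s [s0 _ close]] :=
  near_minimizers_close p_gt1 mOmega nu_levy umin m0 e8.
(* [e / 8], doubled by the sum with [w], leaves room for [B * E w <= e / 4]; the
   excess [s] splits into the losses due to [eta] and to [E w < t]. *)
pose eta := Num.min 1 (s / 6 / (m + 1)).
have eta0 : 0 < eta by rewrite lt_min ltr01 !divr_gt0// ltr_wpDl.
have eta1 : eta <= 1 by rewrite ge_min lexx.
have etam : eta * m <= s / 6.
  rewrite mulrC; apply: le_trans (mul_divS_le m0 _); last by rewrite divr_ge0// ltW.
  by rewrite ler_wpM2l// ge_min lexx orbT.
have [C C0 CP] := W_spaceD_le p_gt1 mOmega nu_levy eta0.
have [D D0 DP] := W_spaceB_le p_gt1 mOmega nu_levy eta0.
have [B B0 BP] := W_spaceD_le p_gt1 mOmega nu_levy ltr01.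
pose K := 2 * C + D; have K0 : 0 <= K by rewrite addr_ge0// mulr_ge0.
pose t := Num.min (s / 2 / (K + 1)) (e / 4 / (B + 1)).
have t0 : 0 < t by rewrite lt_min !divr_gt0// ltr_wpDl.
have Kt : K * t <= s / 2.
  apply: le_trans (mul_divS_le K0 _); last by rewrite divr_ge0// ltW.
  by rewrite ler_wpM2l// ge_min lexx.
have Bt : B * t <= e / 4.
  apply: le_trans (mul_divS_le B0 _); last by rewrite divr_ge0// ltW.
  by rewrite ler_wpM2l// ge_min lexx orbT.
exists (t `^ p^-1); first exact: powR_gt0.
move=> v' Tv' /T_norm_lt[|w Fw]; first exact: powR_ge0.
rewrite -powRrM mulVf ?gt_eqF// powRr1 ?(ltW t0)// => wt.
have w0 : 0 <= E w by exact: fine_energy_ge0.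
have [Fu' umin'] := min_extP Tv'; set u' := min_ext v' in Fu' umin' *.
have Kw : K * E w <= s / 2 by apply: le_trans Kt; rewrite ler_wpM2l// ltW.
have Bw : B * E w <= e / 4 by apply: le_trans Bt; rewrite ler_wpM2l// ltW.
have u'm : E u' <= (1 + eta) * m + C * E w.
  have [Wuw le_uw] := CP u w Fu.1 Fw.1; apply: le_trans le_uw; apply: umin'.
  split; first exact: Wuw.
  by apply: filterS2 Fu.2 Fw.2 => x h1 h2 Ox; rewrite -h1// -h2// addrC subrK.
pose u2 x := u' x - w x.
have [Wu2 le_u2] := DP u' w Fu'.1 Fw.1.
have Fu2 : fiber v u2.
  split; first exact: Wu2.
  by apply: filterS2 Fu'.2 Fw.2 => x h1 h2 Ox; rewrite /u2 -h1// -h2// subKr.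
have u2m : E u2 <= m + s.
  apply: (le_trans le_u2).
  have h1 : (1 + eta) * E u' <= (1 + eta) * ((1 + eta) * m + C * E w).
    by rewrite ler_wpM2l// addr_ge0// ltW.
  have h2 : eta * (eta * m) <= eta * m.
    by rewrite -[leRHS]mul1r ler_wpM2r// mulr_ge0// ltW.
  have h3 : eta * (C * E w) <= C * E w.
    by rewrite -[leRHS]mul1r ler_wpM2r// mulr_ge0.
  apply: le_trans (lerD h1 (lexx _)) _.
  have -> : (1 + eta) * ((1 + eta) * m + C * E w) + D * E w =
    m + 2 * (eta * m) + eta * (eta * m) + eta * (C * E w) + C * E w + D * E w by ring.
  have Kw' : 2 * (C * E w) + D * E w <= s / 2.
    by have <- : K * E w = 2 * (C * E w) + D * E w by rewrite /K; ring.
  lra.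
have ms : m <= m + s by rewrite lerDl ltW.
have u2u := close u2 u Fu2 Fu u2m ms.
have Wd := W_spaceB p_gt1 mOmega nu_levy Fu'.1 Fu.1.
have -> : (Wnorm (u' \- u)%R < eps%:E)%E = (E (fun x => (u' x - u x)%R) < eps `^ p).
  exact: (W_norm_lt Wd (ltW eps0)).
rewrite -/e.
have [_] := BP _ w (W_spaceB p_gt1 mOmega nu_levy Fu2.1 Fu.1) Fw.1.
have -> : (fun x => u2 x - u x + w x) = (fun x => u' x - u x).
  by apply/funext => x; rewrite /u2; ring.
move=> le_d; apply: (le_lt_trans le_d).
lra.
Qed.

End extension_operator.

(** * Weighted norms of traces *)

Section weighted_trace.
Variables (R : realType) (d : nat).
Notation X := (eucl R d).
Notation mu := (@leb R d).
Variables (Omega : set X) (p : R) (nu : X -> R).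
Hypotheses (p_gt1 : 1 < p) (mOmega : measurable Omega).
Hypothesis nu_levy : levy_kernel p nu.
Implicit Types (u v w : X -> R).

Variable k : X -> R.
Hypothesis mk : measurable_fun setT (k : borel_eucl R d -> R).
Hypothesis k_ge0 : forall x, 0 <= k x.
Hypothesis nuk : {ae mu, forall h, h != 0 -> nu h = k h}.

Notation Oc := (~` Omega).

Let mOc : measurable Oc. Proof. exact: measurableC. Qed.

(** For [x] in [S], [`|u y|] is controlled by [`|u x|] and [`|u x - u y|];
    averaging against [kap (x - y)] over [x] and integrating over [y], the first
    term is bounded as [kap (x - y)] is integrable in [y], and the second one as
    [kap] is dominated by the kernel. *)
Lemma weighted_trace_le (S : set X) (kap : X -> R) (a M : R)
    (omega : X -> \bar R) :
  measurable S -> S `<=` Omega ->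
  measurable_fun setT (kap : borel_eucl R d -> R) -> (forall h, 0 <= kap h) ->
  0 <= a -> (forall h, kap h <= a * k h) -> 0 <= M ->
  (forall x, S x -> \int[mu]_(y in Oc) (kap (x - y)%R)%:E <= M%:E)%E ->
  (forall y, Oc y -> 0 <= omega y <= \int[mu]_(x in S) (kap (x - y)%R)%:E)%E ->
  exists2 B, 0 <= B & forall v u, fiber Omega p nu v u ->
    (\int[mu]_(y in Oc) ((`|v y| `^ p)%:E * omega y) <=
     B%:E * energy Omega p nu u)%E.
Proof.
move=> mS SO mkap kap0 a0 kapk M0 kapM omega_le.
have [C C0 HC] := powR_normD_le p_gt1 ltr01.
have [_ nu0 _ _] := nu_levy; have [mnu _ _ _] := nu_levy.
have B1 : 0 <= 2 * M by rewrite mulr_ge0.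
have B2 : 0 <= C * a by rewrite mulr_ge0.
exists (2 * M + C * a) => [|v u [Wu vu]]; first by rewrite addr_ge0.
have mu_u : measurable_fun setT u by case: Wu.
have mkapD := measurable_kernel_sub mkap; have mkD := measurable_kernel_sub mk.
have mu1 : measurable_fun setT (fun z : X * X => `|u z.1| `^ p).
  by apply: measurable_normr_powR; exact: measurableT_comp mu_u measurable_fst.
have mu2 : measurable_fun setT (fun z : X * X => `|u z.2| `^ p).
  by apply: measurable_normr_powR; exact: measurableT_comp mu_u measurable_snd.
have muD : measurable_fun setT (fun z : X * X => `|u z.1 - u z.2| `^ p).
  apply: measurable_normr_powR.
  exact: measurable_funB (measurableT_comp mu_u measurable_fst)
    (measurableT_comp mu_u measurable_snd).
pose Fk (z : X * X) : \bar R := (kap (z.1 - z.2))%:E.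
pose F0 (z : X * X) : \bar R := (`|u z.2| `^ p * kap (z.1 - z.2))%:E.
pose F1 (z : X * X) : \bar R := (2 * `|u z.1| `^ p * kap (z.1 - z.2))%:E.
pose F2 (z : X * X) : \bar R := (C * a * (`|u z.1 - u z.2| `^ p * k (z.1 - z.2)))%:E.
have mFk : measurable_fun setT Fk by apply/measurable_EFinP; exact: mkapD.
have mF1 : measurable_fun setT F1.
  apply/measurable_EFinP; apply: measurable_funM mkapD.
  exact: measurable_funM (measurable_cst _) mu1.
have mF2 : measurable_fun setT F2.
  apply/measurable_EFinP; apply: measurable_funM (measurable_cst _) _.
  exact: measurable_funM muD mkD.
have Fk0 z : (0 <= Fk z)%E by rewrite lee_fin.
have F00 z : (0 <= F0 z)%E by rewrite lee_fin mulr_ge0 ?powR_ge0.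
have F10 z : (0 <= F1 z)%E by rewrite lee_fin !mulr_ge0 ?powR_ge0.
have F20 z : (0 <= F2 z)%E by rewrite lee_fin !mulr_ge0 ?powR_ge0.
have F012 z : (F0 z <= F1 z + F2 z)%E.
  rewrite -EFinD lee_fin.
  have le1 : `|u z.2| `^ p <= 2 * `|u z.1| `^ p + C * `|u z.1 - u z.2| `^ p.
    by rewrite distrC; have := HC (u z.1) (u z.2 - u z.1); rewrite subrKC.
  apply: (le_trans (ler_wpM2r (kap0 _) le1)); rewrite mulrDl lerD2l.
  rewrite -!mulrA ler_wpM2l// mulrCA ler_wpM2l ?powR_ge0//.
have sec1 (F : X * X -> \bar R) : measurable_fun setT F ->
    forall x, measurable_fun Oc (fun y => F (x, y)).
  move=> mF x; apply: measurable_funTS.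
  exact: measurableT_comp mF (pair1_measurable x).
have sec2 (F : X * X -> \bar R) : measurable_fun setT F ->
    forall y, measurable_fun S (fun x => F (x, y)).
  move=> mF y; apply: measurable_funTS.
  exact: measurableT_comp mF (pair2_measurable y).
have mF12 : measurable_fun setT (fun z => F1 z + F2 z)%E by exact: emeasurable_funD.
have F120 z : (0 <= F1 z + F2 z)%E by rewrite adde_ge0.
have mupc : measurable_fun Oc (fun y => (`|u y| `^ p)%:E).
  by apply: measurable_funTS; apply/measurable_EFinP; exact: measurable_normr_powR.
have IG0 y : (0 <= \int[mu]_(x in S) Fk (x, y))%E.
  by apply: integral_ge0 => x _; exact: Fk0.
have mIG : measurable_fun Oc (fun y => \int[mu]_(x in S) Fk (x, y))%E.
  exact: (measurable_tonelli2 mu mS mOc mFk Fk0).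
apply: (@le_trans _ _
    (\int[mu]_(y in Oc) ((`|u y| `^ p)%:E * \int[mu]_(x in S) Fk (x, y)))%E).
  apply: (ae_le_integral_ge0 mOc).
  - move=> y Oy; have /andP[w0 _] := omega_le y Oy.
    by apply: mule_ge0 w0; rewrite lee_fin powR_ge0.
  - by move=> y Oy; apply: mule_ge0 (IG0 y); rewrite lee_fin powR_ge0.
  - exact: emeasurable_funM mupc mIG.
  apply: filterS vu => y vuy Oy; rewrite vuy//.
  have /andP[_ wle] := omega_le y Oy.
  by apply: lee_wpmul2l wle; rewrite lee_fin powR_ge0.
apply: (@le_trans _ _
    (\int[mu]_(y in Oc) \int[mu]_(x in S) (F1 (x, y) + F2 (x, y)))%E).
  apply: (@le_integral_ge0 _ _ _ mu Oc Oc); first exact: subset_refl.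
  - by move=> y _; apply: mule_ge0 (IG0 y); rewrite lee_fin powR_ge0.
  - by move=> y _; apply: integral_ge0 => x _; exact: F120.
  move=> y _; rewrite -(ge0_integralZl_EFin mu mS (fun x _ => Fk0 (x, y))
    (sec2 _ mFk y) (powR_ge0 _ _)).
  apply: (@le_integral_ge0 _ _ _ mu S S); first exact: subset_refl.
  - by move=> x _; apply: mule_ge0 (Fk0 (x, y)); rewrite lee_fin powR_ge0.
  - by move=> x _; exact: F120.
  - by move=> x _; exact: (F012 (x, y)).
rewrite -(tonelli_rectangle2 mu mu mS mOc mF12 F120).
rewrite (tonelli_rectangle1 mu mu mS mOc mF12 F120).
have -> : (\int[mu]_(x in S) \int[mu]_(y in Oc) (F1 (x, y) + F2 (x, y)) =
    \int[mu]_(x in S) \int[mu]_(y in Oc) F1 (x, y) +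
    \int[mu]_(x in S) \int[mu]_(y in Oc) F2 (x, y))%E.
  rewrite -(ge0_integralD mu mS _ (measurable_tonelli1 mu mS mOc mF1 F10)
    _ (measurable_tonelli1 mu mS mOc mF2 F20)).
  - apply: eq_integral => x _; rewrite (ge0_integralD mu mOc
      (fun y _ => F10 (x, y)) (sec1 _ mF1 x)
      (fun y _ => F20 (x, y)) (sec1 _ mF2 x)); exact: erefl.
  - by move=> x _; apply: integral_ge0 => y _; exact: F10.
  - by move=> x _; apply: integral_ge0 => y _; exact: F20.
rewrite energyE (ge0_muleDr _ (Lp_energy_ge0 Omega p u)
  (nonlocal_energy_ge0 Omega p_gt1 nu_levy u)).
apply: leeD.
  apply: (@le_trans _ _ ((2 * M)%:E * Lp_energy p Omega u)%E); last first.
    apply: lee_wpmul2r; first exact: Lp_energy_ge0.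
    by rewrite lee_fin lerDl.
  have mup : measurable_fun Omega (fun y => (`|u y| `^ p)%:E).
    by apply: measurable_funTS; apply/measurable_EFinP; exact: measurable_normr_powR.
  have up0 x : Omega x -> (0 <= (`|u x| `^ p)%:E)%E by rewrite lee_fin powR_ge0.
  rewrite /Lp_energy -(ge0_integralZl_EFin mu mOmega up0 mup B1).
  apply: (@le_integral_ge0 _ _ _ mu S Omega); first exact: SO.
  - by move=> x _; apply: integral_ge0 => y _; exact: F10.
  - by move=> x Ox; exact: mule_ge0 (B1 : (0 <= (2 * M)%:E)%E) (up0 x Ox).
  move=> x Sx; have u20 : 0 <= 2 * `|u x| `^ p by rewrite mulr_ge0 ?powR_ge0.
  have -> : (\int[mu]_(y in Oc) F1 (x, y) =
      (2 * `|u x| `^ p)%:E * \int[mu]_(y in Oc) Fk (x, y))%E.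
    rewrite -(ge0_integralZl_EFin mu mOc (fun y _ => Fk0 (x, y)) (sec1 _ mFk x) u20).
    by apply: eq_integral => y _; rewrite -EFinM.
  apply: le_trans (lee_wpmul2l _ (kapM x Sx)) _; first by rewrite lee_fin.
  by rewrite -!EFinM lee_fin mulrAC.
apply: (@le_trans _ _ ((C * a)%:E * nonlocal_energy p nu Omega u)%E); last first.
  apply: lee_wpmul2r; first exact: nonlocal_energy_ge0 p_gt1 nu_levy _.
  by rewrite lee_fin lerDr.
rewrite (nonlocal_energy_kernel Omega p_gt1 mnu nu0 mk k_ge0 nuk mu_u).
pose F3 (z : X * X) : \bar R := (`|u z.1 - u z.2| `^ p * k (z.1 - z.2))%:E.
have mF3 : measurable_fun setT F3.
  by apply/measurable_EFinP; exact: measurable_funM muD mkD.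
have F30 z : (0 <= F3 z)%E by rewrite lee_fin mulr_ge0 ?powR_ge0.
have IF0 x : (0 <= \int[mu]_y F3 (x, y))%E.
  by apply: integral_ge0 => y _; exact: F30.
rewrite -(ge0_integralZl_EFin mu mOmega (fun x _ => IF0 x)
  (measurable_tonelli1 mu mOmega measurableT mF3 F30) B2).
apply: (@le_integral_ge0 _ _ _ mu S Omega); first exact: SO.
- by move=> x _; apply: integral_ge0 => y _; exact: F20.
- by move=> x _; exact: mule_ge0 (B2 : (0 <= (C * a)%:E)%E) (IF0 x).
move=> x _.
rewrite -(ge0_integralZl_EFin mu measurableT (fun y _ => F30 (x, y))
  (measurableT_comp mF3 (pair1_measurable x)) B2).
apply: (@le_integral_ge0 _ _ _ mu Oc setT); first exact: subsetT.
- by move=> y _; exact: F20.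
- by move=> y _; exact: mule_ge0 (B2 : (0 <= (C * a)%:E)%E) (F30 (x, y)).
- by move=> y _; rewrite -EFinM.
Qed.

End weighted_trace.

(** * The three weights *)

Section weights.
Variables (R : realType) (d : nat).
Notation X := (eucl R d).
Notation mu := (@leb R d).
Variables (Omega : set X) (p : R) (nu : X -> R).
Hypotheses (p_gt1 : 1 < p) (Omega_open : open Omega).
Hypothesis nu_levy : levy_kernel p nu.
Implicit Types (u v w : X -> R) (omega : X -> \bar R).

Notation Oc := (~` Omega).
Notation energy := (energy Omega p nu).

Let p_gt0 : 0 < p. Proof. exact: lt_trans p_gt1. Qed.

Let mOmega : measurable Omega. Proof. exact: measurable_open. Qed.

Let mOc : measurable Oc. Proof. exact: measurableC. Qed.

Let nu_ge0 h : h != 0 -> 0 <= nu h. Proof. by case: nu_levy => _ + _ _; exact. Qed.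

Let nuN (x y : X) : x != y -> nu (y - x) = nu (x - y).
Proof.
by case: nu_levy => _ _ + _ xy; rewrite -(opprB x y); apply; rewrite subr_eq0.
Qed.

Let Oc_neq (x y : X) : Omega x -> Oc y -> x != y.
Proof. by move=> Ox Oy; apply/eqP => xy; apply: Oy; rewrite -xy. Qed.

(** Boundedness of the trace operator into the weighted space, in p-th powers
    and uniformly over all extensions. *)
Definition weight_controlled omega : Prop := exists2 B, 0 <= B &
  forall v u, fiber Omega p nu v u ->
  (\int[mu]_(y in Oc) ((`|v y| `^ p)%:E * omega y) <= B%:E * energy u)%E.

Lemma ae_leb_translate (P : X -> Prop) (y : X) :
  {ae mu, forall h, P h} -> {ae mu, forall x, P (x - y)}.
Proof.
move=> /(ae_leb_reflect 0)/(ae_leb_reflect y).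
by apply: filterS => x; rewrite sub0r opprB.
Qed.

(** The integrand of the Levy condition as a total function. *)
Lemma levy_integrand : exists L : X -> R,
  [/\ measurable_fun setT L, forall h, 0 <= L h,
      (\int[mu]_h (L h)%:E < +oo)%E &
      forall h, h != 0 -> L h = Num.min 1 (enorm h `^ p) * nu h].
Proof.
have [mnu _ _ fin] := nu_levy.
have mC : measurable (~` [set (0 : X)]).
  by apply: measurableC; exact: measurable_eucl1.
have mmin : measurable_fun setT (fun h : X => Num.min 1 (enorm h `^ p)).
  apply: measurable_minr; first exact: measurable_cst.
  exact: measurableT_comp (measurable_powR p) (@measurable_enorm R d).
pose f (h : X) := Num.min 1 (enorm h `^ p) * nu h.
have LE (h : X) : h != 0 -> (f \_ (~` [set (0 : X)])) h = f h.
  by move=> h0; rewrite patchE ifT// inE/=; exact/eqP.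
exists (f \_ (~` [set (0 : X)])); split.
- apply: (measurable_restrictT _ mC).1; apply: measurable_funM mnu.
  exact: measurable_funTS.
- move=> h; rewrite patchE; case: ifPn => // /set_mem /eqP h0.
  by rewrite mulr_ge0 ?nu_ge0// le_min ler01 powR_ge0.
- move: fin; rewrite integral_mkcond; congr (_ < _)%E; apply: eq_integral => h _.
  by rewrite !patchE; case: ifPn.
- exact: LE.
Qed.

Lemma kernel_section_integral_le (kap L : X -> R) (x : X) :
  measurable_fun setT L -> (forall h, 0 <= L h) -> (forall h, 0 <= kap h) ->
  {ae mu, forall y, Oc y -> kap (x - y) <= L (x - y)} ->
  (\int[mu]_(y in Oc) (kap (x - y)%R)%:E <= \int[mu]_h (L h)%:E)%E.
Proof.
move=> mL L0 kap0 kL; pose G h : \bar R := (L h)%:E.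
have mG : measurable_fun setT G by exact/measurable_EFinP.
have G0 h : (0 <= G h)%E by rewrite lee_fin.
rewrite -(integral_reflect x mG G0).
apply: (@le_trans _ _ (\int[mu]_(y in Oc) G (x - y)%R)%E).
  apply: (ae_le_integral_ge0 mOc).
  - by move=> y _; rewrite lee_fin.
  - by move=> y _; exact: G0.
  - apply: measurable_funTS; exact: measurableT_comp mG (measurable_reflect x).
  - by apply: filterS kL => y kLy Oy; rewrite lee_fin kLy.
apply: (@le_integral_ge0 _ _ _ mu Oc setT); first exact: subsetT.
- by move=> y _; exact: G0.
- by move=> y _; exact: G0.
- by move=> y _; exact: lexx.
Qed.

Definition admissible_weight (r : R) omega : Prop :=
  omega = nu_tilde nu Omega \/ omega = nu_bar nu Omega \/
  (omega = nu_hat nu r /\ unimodal nu).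

Let axis_neq0 (r : R) (y : X) : 0 < r ->
  (r * (1 + enorm y)) *: (delta_mx 0 0 : X) != 0.
Proof.
move=> r0; rewrite -enorm_gt0 enorm_axis normr_gt0 gt_eqF//.
by apply: mulr_gt0 r0 _; rewrite ltr_wpDr ?enorm_ge0.
Qed.

Lemma weight_ge0 (r : R) omega (y : X) : 0 < r -> admissible_weight r omega ->
  Oc y -> (0 <= omega y)%E.
Proof.
move=> r0 [->|[->|[-> _]]] Oy.
- apply: integral_ge0 => x Ox; rewrite lee_fin le_min ler01/= nu_ge0//.
  by rewrite subr_eq0 eq_sym Oc_neq.
- apply/ess_infP; apply: aeW => x; rewrite /patch.
  case: ifPn => [/set_mem Ox|_]; last exact: leey.
  by rewrite lee_fin nu_ge0// subr_eq0 eq_sym Oc_neq.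
- by rewrite lee_fin nu_ge0// axis_neq0.
Qed.

Section borel_kernel.
Variable k : X -> R.
Hypothesis mk : measurable_fun setT (k : borel_eucl R d -> R).
Hypothesis k_ge0 : forall x, 0 <= k x.
Hypothesis nuk : {ae mu, forall h, h != 0 -> nu h = k h}.

(** [Num.min 1 nu] is integrable: it is at most 1 on the unit box and at most
    [Num.min 1 (enorm h `^ p) * nu h] off it. *)
Lemma nu_tilde_controlled : weight_controlled (nu_tilde nu Omega).
Proof.
have [L [mL L0 Lfin LE]] := levy_integrand.
pose one : X := const_mx 1.
pose Q : set X := box (- one) one.
have mQ : measurable Q by exact: measurable_box.
pose kap (h : X) := Num.min 1 (k h).
have kap0 h : 0 <= kap h by rewrite le_min ler01 k_ge0.
pose L' (h : X) : R := \1_Q h + L h.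
have mQ1 : measurable_fun setT (\1_Q : X -> R) by exact: measurable_indic.
have mL' : measurable_fun setT L' by exact: measurable_funD mQ1 mL.
have L'0 h : 0 <= L' h by rewrite addr_ge0// indicE.
have L'fin : (\int[mu]_h (L' h)%:E < +oo)%E.
  have -> : (\int[mu]_h (L' h)%:E = \int[mu]_h (\1_Q h)%:E + \int[mu]_h (L h)%:E)%E.
    rewrite -(ge0_integralD mu measurableT).
    - by apply: eq_integral => h _; rewrite EFinD.
    - by move=> h _; rewrite lee_fin indicE.
    - exact/measurable_EFinP.
    - by move=> h _; rewrite lee_fin.
    - exact/measurable_EFinP.
  rewrite integral_indic// setIT lte_add_pinfty//.
  exact: le_lt_trans (leb_box _ _) (ltry _).
have kapL x : Omega x -> {ae mu, forall y, Oc y -> kap (x - y) <= L' (x - y)}.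
  move=> Ox; apply: filterS (kernel_section_ae nuk x) => y kE Oy.
  have xy := Oc_neq Ox Oy; have hx : x - y != 0 by rewrite subr_eq0.
  rewrite /kap -kE 1?eq_sym// /L' LE// indicE.
  have [/set_mem Qh|Qh] := boolP (_ \in Q).
    apply: (@le_trans _ _ 1); first by rewrite ge_min lexx.
    by rewrite lerDl mulr_ge0 ?nu_ge0// le_min ler01 powR_ge0.
  have h1 : 1 <= enorm (x - y).
    move: Qh; rewrite notin_setE => /existsNP[i /negP hi].
    apply: le_trans (coord_le_enorm _ i); apply: ltW; rewrite ltNge.
    by apply: contra hi; rewrite !mxE ler_norml.
  have hp : 1 <= enorm (x - y) `^ p.
    apply: (@le_trans _ _ (1 `^ p)); first by rewrite powR1.
    by apply: ge0_ler_powR; rewrite ?nnegrE ?enorm_ge0 ?(ltW p_gt0).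
  rewrite add0r (min_idPl hp).
  by rewrite mul1r ge_min lexx orbT.
have mkap : measurable_fun setT (kap : borel_eucl R d -> R).
  exact: measurable_minr (measurable_cst _) mk.
have M0 : 0 <= fine (\int[mu]_h (L' h)%:E).
  by rewrite fine_ge0// integral_ge0// => h _; rewrite lee_fin.
apply: (weighted_trace_le p_gt1 mOmega nu_levy mk k_ge0 nuk mOmega
  (@subset_refl _ Omega) mkap kap0 ler01 _ M0).
- by move=> h; rewrite mul1r ge_min lexx orbT.
- move=> x Ox; rewrite fineK; last first.
    by rewrite ge0_fin_numE// integral_ge0// => h _; rewrite lee_fin.
  exact: kernel_section_integral_le mL' L'0 kap0 (kapL x Ox).
move=> y Oy; apply/andP; split.
  exact: (@weight_ge0 1 _ y ltr01 (or_introl erefl) Oy).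
apply: (ae_le_integral_ge0 mOmega).
- move=> x Ox; rewrite lee_fin le_min ler01/= nu_ge0//.
  by rewrite subr_eq0 eq_sym Oc_neq.
- by move=> x _; rewrite lee_fin.
- apply/measurable_EFinP; apply: measurable_funTS.
  exact: measurableT_comp (measurable_kernel_sub mkap) (pair2_measurable y).
apply: filterS (ae_leb_translate y nuk) => x kE Ox.
have xy := Oc_neq Ox Oy.
by rewrite lee_fin nuN// kE ?subr_eq0.
Qed.

(** Averaging over a set [K] at positive distance from the complement, on whose
    differences with the complement the kernel is integrable. *)
Lemma average_controlled (K : set X) (delta c : R) omega :
  0 < delta -> measurable K -> (0 < mu K < +oo)%E -> K `<=` Omega ->
  (forall x y, K x -> Oc y -> delta <= enorm (x - y)) -> 0 <= c ->
  (forall y, Oc y -> (0 <= omega y)%E) ->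
  (forall y, Oc y -> {ae mu, forall x, K x -> (omega y <= (c * nu (x - y)%R)%:E)%E}) ->
  weight_controlled omega.
Proof.
move=> delta0 mK /andP[K0 Koo] KO dK c0 omega0 omega_le.
have [L [mL L0 Lfin LE]] := levy_integrand.
pose m := fine (mu K).
have muKE : mu K = m%:E by rewrite fineK// ge0_fin_numE// ltW.
have m0 : 0 < m by rewrite -lte_fin -muKE.
pose a := c / m; have a0 : 0 <= a by rewrite divr_ge0// ltW.
(* A lower bound for [Num.min 1 (enorm h `^ p)] over [delta <= enorm h]. *)
pose q := Num.min 1 (delta `^ p).
have q0 : 0 < q by rewrite lt_min ltr01 powR_gt0.
pose kap (h : X) := a * k h.
have kap0 h : 0 <= kap h by rewrite mulr_ge0.
have mkap : measurable_fun setT (kap : borel_eucl R d -> R).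
  exact: measurable_funM (measurable_cst _) mk.
pose L' (h : X) := a / q * L h.
have aq0 : 0 <= a / q by rewrite divr_ge0// ltW.
have L'0 h : 0 <= L' h by rewrite mulr_ge0.
have mL' : measurable_fun setT L' by exact: measurable_funM (measurable_cst _) mL.
have L'fin : (\int[mu]_h (L' h)%:E < +oo)%E.
  have -> : (\int[mu]_h (L' h)%:E = (a / q)%:E * \int[mu]_h (L h)%:E)%E.
    have LE0 h : setT h -> (0 <= (L h)%:E)%E by rewrite lee_fin.
    have mLE : measurable_fun setT (fun h => (L h)%:E) by exact/measurable_EFinP.
    rewrite -(ge0_integralZl_EFin mu measurableT LE0 mLE aq0).
    by apply: eq_integral => h _; rewrite -EFinM.
  by rewrite lte_mul_pinfty// ?lee_fin.
have kapL x : K x -> {ae mu, forall y, Oc y -> kap (x - y) <= L' (x - y)}.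
  move=> Kx; apply: filterS (kernel_section_ae nuk x) => y kE Oy.
  have xy := Oc_neq (KO _ Kx) Oy; have hx : x - y != 0 by rewrite subr_eq0.
  rewrite /kap -kE 1?eq_sym// /L' LE// -mulrA ler_wpM2l//.
  rewrite mulrA ler_peMl ?nu_ge0// mulrC ler_pdivlMr// mul1r.
  rewrite /q le_min ge_min lexx/= ge_min; apply/orP; right.
  apply: ge0_ler_powR; rewrite ?nnegrE ?(ltW p_gt0) ?enorm_ge0 ?(ltW delta0)//.
  exact: dK.
have M0 : 0 <= fine (\int[mu]_h (L' h)%:E).
  by rewrite fine_ge0// integral_ge0// => h _; rewrite lee_fin.
apply: (weighted_trace_le p_gt1 mOmega nu_levy mk k_ge0 nuk mK KO mkap kap0 a0 _ M0).
- by move=> h; exact: lexx.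
- move=> x Kx; rewrite fineK; last first.
    by rewrite ge0_fin_numE// integral_ge0// => h _; rewrite lee_fin.
  exact: kernel_section_integral_le mL' L'0 kap0 (kapL x Kx).
move=> y Oy; rewrite omega0//=.
have mks : measurable_fun K (fun x => (c * k (x - y))%:E).
  apply/measurable_EFinP; apply: measurable_funTS.
  apply: measurable_funM (measurable_cst _) _.
  exact: measurableT_comp (measurable_kernel_sub mk) (pair2_measurable y).
have ks0 x : K x -> (0 <= (c * k (x - y)%R)%:E)%E by rewrite lee_fin mulr_ge0.
have le_avg : (omega y * mu K <= \int[mu]_(x in K) (c * k (x - y)%R)%:E)%E.
  rewrite -(integral_cst mu mK); apply: (ae_le_integral_ge0 mK) => //.
    by move=> x _; exact: omega0.
  apply: filterS2 (omega_le y Oy) (ae_leb_translate y nuk) => x le_x kE Kx.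
  by rewrite /= -kE ?le_x// subr_eq0 Oc_neq//; exact: KO.
have -> : (\int[mu]_(x in K) (kap (x - y)%R)%:E =
    (m^-1)%:E * \int[mu]_(x in K) (c * k (x - y)%R)%:E)%E.
  rewrite -(ge0_integralZl_EFin mu mK ks0 mks) ?invr_ge0 ?(ltW m0)//.
  by apply: eq_integral => x _; rewrite -EFinM /kap /a mulrA (mulrC m^-1).
have -> : omega y = ((m^-1)%:E * (omega y * mu K))%E.
  by rewrite muKE (muleC (omega y)) muleA -EFinM mulVf ?gt_eqF// mul1e.
by apply: lee_wpmul2l le_avg; rewrite lee_fin invr_ge0 ltW.
Qed.

End borel_kernel.

(** The essential infimum is at most [nu (x - y)] for almost all [x] in [K]. If
    [x] is in the ball of radius [r], then [enorm (x - y) <= r * (1 + enorm y)],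
    so a unimodal kernel satisfies [c * nu_hat nu r y <= nu (x - y)]. *)
Lemma admissible_weight_controlled (r : R) omega : 1 < r ->
  (0 < mu (eball r `&` Omega))%E -> admissible_weight r omega ->
  weight_controlled omega.
Proof.
move=> r1 rO omegaE; have r0 : 0 < r by exact: lt_trans ltr01 r1.
have omega0 y := @weight_ge0 r omega y r0 omegaE.
have [mnu _ _ _] := nu_levy.
have [k [mk k0 nuk]] := kernel_borel_version mnu nu_ge0.
have [K [delta [delta0 mK muK KA dK]]] :=
  open_positive_separated Omega_open (@measurable_eball R d r) rO.
have KO : K `<=` Omega by move=> x /KA[].
case: omegaE omega0 => [->|[->|[-> [_ [c [c0 nu_unimodal]]]]]] omega0.
- exact: nu_tilde_controlled mk k0 nuk.
- apply: (average_controlled mk k0 nuk delta0 mK muK KO dK ler01 omega0) => y Oy.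
  pose f := patch (fun=> +oo%E) Omega (fun x => (nu (y - x))%:E).
  apply: filterS (ess_inf_le mu f) => x le_f Kx; apply: (le_trans le_f).
  rewrite /f /patch ifT; last by rewrite inE; exact: KO.
  by rewrite mul1r nuN//; exact: Oc_neq (KO _ Kx) Oy.
- have ci0 : 0 <= c^-1 by rewrite invr_ge0 ltW.
  apply: (average_controlled mk k0 nuk delta0 mK muK KO dK ci0 omega0) => y Oy.
  apply: aeW => x Kx; have xy := Oc_neq (KO _ Kx) Oy.
  rewrite lee_fin ler_pdivlMl//; apply: nu_unimodal.
  + by rewrite subr_eq0.
  + exact: axis_neq0.
  rewrite enorm_axis ger0_norm ?mulr_ge0 ?addr_ge0 ?enorm_ge0 ?(ltW r0)//.
  apply: le_trans (enormD_le _ _) _; rewrite enormN mulrDr mulr1 lerD//.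
    by have [/ltW + _] := KA _ Kx; exact.
  by rewrite ler_peMl ?enorm_ge0// ltW.
Qed.

(** The weighted norm of a trace is bounded by the energy of any of its
    extensions. *)
Lemma trace_embedding_continuous omega :
  weight_controlled omega -> (forall y, Oc y -> (0 <= omega y)%E) ->
  seminorm_continuous (T_space p nu Omega) (wLp_space p omega Omega)
    (T_norm p nu Omega) (wLp_norm p omega Omega) id.
Proof.
move=> [B B0 HB] omega0; pose J v := (\int[mu]_(y in Oc) ((`|v y| `^ p)%:E * omega y))%E.
have J0 v : (0 <= J v)%E.
  by apply: integral_ge0 => y Oy; rewrite mule_ge0 ?omega0// lee_fin powR_ge0.
have J_le v u : fiber Omega p nu v u ->
    (J v <= (B * fine_energy Omega p nu u)%:E)%E.
  by move=> Fu; rewrite EFinM -(fine_energyE p_gt1 nu_levy Fu.1); exact: HB.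
split=> [v [mv [u Wu vu]]|v Tv eps eps0].
  split; first exact: mv.
  have := J_le v u (conj Wu vu); rewrite /wLp_norm -/(J v).
  case: (J v) (J0 v) => [j|//|//] j0 _.
  by rewrite poweR_EFin ltry.
pose e := eps `^ p; have e0 : 0 < e by exact: powR_gt0.
have B1 : 0 < B + 1 by rewrite ltr_wpDl.
pose t := e / (B + 1); have t0 : 0 < t by rewrite divr_gt0.
exists (t `^ p^-1); first exact: powR_gt0.
move=> v' Tv' /(T_norm_lt p_gt1 nu_levy (powR_ge0 _ _))[w Fw].
rewrite -powRrM mulVf ?gt_eqF// powRr1 ?(ltW t0)// => wt.
have := J_le _ w Fw; rewrite /wLp_norm -/(J _).
case: (J _) (J0 (v' \- v)) => [j|//|//]; rewrite !lee_fin => j0 jB.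
rewrite poweR_EFin lte_fin (ltr_powRV p_gt1 j0 (ltW eps0)) -/e.
apply: (le_lt_trans jB); apply: (@le_lt_trans _ _ (B * t)).
  by rewrite ler_wpM2l// ltW.
rewrite /t mulrA ltr_pdivrMr// mulrC.
by rewrite ltr_pM2l// ltrDl.
Qed.

End weights.

(** * Traces and extensions *)

Theorem theorem5p15 (R : realType) (d : nat) (Omega : set (eucl R d)) (p : R)
    (nu : eucl R d -> R) (r : R) (omega : eucl R d -> \bar R)
    (Omega_open : open Omega) (p_gt1 : 1 < p) (nu_levy : levy_kernel p nu)
    (r_gt1 : 1 < r) (r_Omega : (0 < @leb R d (eball r `&` Omega))%E)
    (omegaE : omega = nu_tilde nu Omega \/
              omega = nu_bar nu Omega \/
              (omega = nu_hat nu r /\ unimodal nu)) :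
  (* (i) *)
  ([set u | W_space p nu Omega u /\
            ae_eq (@leb R d) (~` Omega) (trace Omega u) (cst 0)]
     = W0_space p nu Omega /\
   [set v | measurable_fun (~` Omega) v /\
            exists2 u, W_space p nu Omega u &
              ae_eq (@leb R d) (~` Omega) (trace Omega u) v]
     = T_space p nu Omega) /\
  (* (ii) *)
  (seminorm_continuous (W_space p nu Omega) (T_space p nu Omega)
     (W_norm p nu Omega) (T_norm p nu Omega) (trace Omega) /\
   seminorm_continuous (T_space p nu Omega) (wLp_space p omega Omega)
     (T_norm p nu Omega) (wLp_norm p omega Omega) id) /\
  (* (iii) *)
  (bounded_in_one_direction Omega ->
   exists Ext : (eucl R d -> R) -> (eucl R d -> R),
     [/\ seminorm_bounded (T_space p nu Omega)
           (T_norm p nu Omega) (W_norm p nu Omega) Ext,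
         seminorm_continuous (T_space p nu Omega) (W_space p nu Omega)
           (T_norm p nu Omega) (W_norm p nu Omega) Ext &
         forall v, T_space p nu Omega v ->
           ae_eq (@leb R d) (~` Omega) (trace Omega (Ext v)) v]).
Proof.
have mOmega : measurable Omega by exact: measurable_open.
have traceE u x : (~` Omega) x -> trace Omega u x = u x.
  by move=> Ox; rewrite /trace/= /patch ifT// inE.
have ae_trace u v : ae_eq (@leb R d) (~` Omega) (trace Omega u) v <->
    ae_eq (@leb R d) (~` Omega) v u.
  by split; apply: filterS => x uv Ox; [rewrite -uv// traceE|rewrite traceE// uv].
split; [split|split; [split|]].
- apply/seteqP; split => u [Wu u0]; split=> //.
    by apply: filterS u0 => x u0 Ox; rewrite -u0// traceE.
  by apply: filterS u0 => x u0 Ox; rewrite traceE// u0.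
- apply/seteqP; split => v [mv [u Wu uv]]; split=> //; exists u => //; exact/ae_trace.
- have trace_fiber u : W_space p nu Omega u -> T_space p nu Omega (trace Omega u).
    move=> Wu; split; last by exists u; [exact: Wu|exact/ae_trace/ae_eq_refl].
    have [mu_u _ _] := Wu.
    apply: (eq_measurable_fun u); last exact: measurable_funTS.
    by move=> x /set_mem Ox; rewrite traceE.
  split; first exact: trace_fiber.
  move=> u Wu eps eps0; exists eps; first exact: eps0.
  move=> u' Wu' uu'.
  apply: le_lt_trans uu'; apply: ereal_inf_lbound.
  have Wd := W_spaceB p_gt1 mOmega nu_levy Wu' Wu.
  exists (u' \- u); last exact: erefl.
  split; first exact: Wd.
  by apply: aeW => x Ox; congr (_ - _); exact: traceE.
- have r_gt0 : 0 < r by exact: lt_trans r_gt1.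
  apply: (trace_embedding_continuous p_gt1 nu_levy).
    exact: (admissible_weight_controlled p_gt1 Omega_open nu_levy r_gt1 r_Omega omegaE).
  by move=> y; exact: (weight_ge0 nu_levy r_gt0 omegaE).
move=> _; exists (min_ext Omega p nu); split.
- exact: (min_ext_bounded p_gt1 mOmega nu_levy).
- exact: (min_ext_continuous p_gt1 mOmega nu_levy).
- by move=> v /(min_extP p_gt1 mOmega nu_levy)[[_ vu] _]; exact/ae_trace.
Qed.
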